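(* Let $r\ge 2$ and fix a $\mathscr C^r$ expanding map $E:\mathbb{S}^1\to\mathbb{S}^1$ of degree $\ell\ge 2$. For every $\varrho>1$ there is an open dense subset $\mathscr V\subset\mathscr C^r(\mathbb{S}^1)$ (real-valued $\mathscr C^r$ functions with the $\mathscr C^r$ topology) such that $\mathcal N(\tau)<\varrho$ for every $\tau\in\mathscr V$. Consequently, there is a residual subset $\mathscr R\subset\mathscr C^r(\mathbb{S}^1)$ such that $\mathcal N(\tau)=1$ for every $\tau\in\mathscr R$ (i.e. $f_{E,\tau}$ is partially captive for generic $\tau$).
   Context: Let $\mathbb{S}^1=\mathbb{R}/\mathbb{Z}$ and $\mathbb{T}^2=\mathbb{S}^1\times\mathbb{S}^1$. Let $E$ be a $\mathscr C^r$ expanding map of degree $\ell\ge2$ and let $1<\lambda\le\Lambda$ be constants with $\lambda\le E'(x)\le\Lambda$ for all $x\in\mathbb{S}^1$. For $\tau\in\mathscr C^r(\mathbb{S}^1,\mathbb{R})$ let $f=f_{E,\tau}:\mathbb{T}^2\to\mathbb{T}^2$, $f(x,s)=(E(x),\,s+\tau(x)\bmod 1)$, so that $Df(x,s)=\begin{pmatrix}E'(x)&0\\ \tau'(x)&1\end{pmatrix}$. For $R>0$ set $\vartheta_R=R/(\lambda-1)$ and let $\mathscr K_R=\{(\xi,\eta)\in\mathbb{R}^2:|\eta|\le\vartheta_R|\xi|\}$. For $R>\|\tau'\|_\infty$ and $n\ge1$ define $\mathcal N(\tau,R;n)=\sup_{z\in\mathbb{T}^2}\sup_{v}\#\{\zeta\in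 f^{-n}(z): v\in Df^n(\zeta)\mathscr K_R\}$, where $\sup_v$ is over unit vectors $v\in\mathbb{R}^2$. The sequence $n\mapsto\mathcal N(\tau,R;n)$ is submultiplicative, the limit $\mathcal N(\tau)=\lim_{n\to\infty}\mathcal N(\tau,R;n)^{1/n}=\inf_n\mathcal N(\tau,R;n)^{1/n}$ exists and does not depend on the choice of $R>\|\tau'\|_\infty$. $f_{E,\tau}$ is called partially captive if $\mathcal N(\tau)=1$. *)

(* Defs.v *)
From Stdlib Require Import Reals Lra List.
Open Scope R_scope.

Definition DerivSeq (r : nat) (f : R -> R) (d : nat -> R -> R) : Prop :=
  (forall x, d 0%nat x = f x) /\
  (forall (k : nat) (x : R), (k < r)%nat -> derivable_pt_lim (d k) x (d (S k) x)) /\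
  continuity (d r).

Definition Cr (r : nat) (f : R -> R) : Prop := exists d, DerivSeq r f d.

(** Functions on S^1 = R/Z are represented by 1-periodic functions on R. *)
Definition Periodic1 (f : R -> R) : Prop := forall x, f (x + 1) = f x.

Definition CrS1 (r : nat) (tau : R -> R) : Prop := Cr r tau /\ Periodic1 tau.

Definition CircleLift (l : nat) (E : R -> R) : Prop :=
  forall x, E (x + 1) = E x + INR l.

(** sigma lies in the open C^r ball of radius eps around tau:
    max_{k<=r} sup_x |sigma^(k) x - tau^(k) x| < eps
    (sups of continuous periodic functions are attained). *)
Definition CrClose (r : nat) (sigma tau : R -> R) (eps : R) : Prop :=
  exists ds dt, DerivSeq r sigma ds /\ DerivSeq r tau dt /\
    forall (k : nat) (x : R), (k <= r)%nat -> Rabs (ds k x - dt k x) < eps.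

Definition OpenCr (r : nat) (V : (R -> R) -> Prop) : Prop :=
  (forall tau, V tau -> CrS1 r tau) /\
  forall tau, V tau -> exists eps, eps > 0 /\
    forall sigma, CrS1 r sigma -> CrClose r sigma tau eps -> V sigma.

Definition DenseCr (r : nat) (V : (R -> R) -> Prop) : Prop :=
  forall tau eps, CrS1 r tau -> eps > 0 ->
    exists sigma, V sigma /\ CrClose r sigma tau eps.

Definition ResidualCr (r : nat) (S : (R -> R) -> Prop) : Prop :=
  (forall tau, S tau -> CrS1 r tau) /\
  exists U : nat -> ((R -> R) -> Prop),
    (forall n, OpenCr r (U n) /\ DenseCr r (U n)) /\
    (forall tau, CrS1 r tau -> (forall n, U n tau) -> S tau).

Definition eqmod1 (a b : R) : Prop := exists k : Z, a - b = IZR k.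
Definition torus_eq (p q : R * R) : Prop :=
  eqmod1 (fst p) (fst q) /\ eqmod1 (snd p) (snd q).

Definition Flift (E tau : R -> R) (p : R * R) : R * R :=
  (E (fst p), snd p + tau (fst p)).

Fixpoint Fiter (E tau : R -> R) (n : nat) (p : R * R) : R * R :=
  match n with
  | O => p
  | S m => Fiter E tau m (Flift E tau p)
  end.

(** Df^n(zeta) w = Df(f^{n-1} zeta) ... Df(zeta) w, where
    Df(x,s) = [[E'(x), 0], [tau'(x), 1]]. *)
Fixpoint Dfn (E E' Dtau : R -> R) (n : nat) (x : R) (w : R * R) : R * R :=
  match n with
  | O => w
  | S m => Dfn E E' Dtau m (E x) (E' x * fst w, Dtau x * fst w + snd w)
  end.

Definition InCone (lam Rc : R) (w : R * R) : Prop :=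
  Rabs (snd w) <= (Rc / (lam - 1)) * Rabs (fst w).

Definition UnitVec (v : R * R) : Prop := fst v ^ 2 + snd v ^ 2 = 1.

Definition Qualifies (E E' tau Dtau : R -> R) (lam Rc : R) (n : nat)
  (z v zeta : R * R) : Prop :=
  torus_eq (Fiter E tau n zeta) z /\
  exists w, InCone lam Rc w /\ Dfn E E' Dtau n (fst zeta) w = v.

Definition GoodList (E E' tau Dtau : R -> R) (lam Rc : R) (n : nat)
  (z v : R * R) (L : list (R * R)) : Prop :=
  UnitVec v /\
  ForallOrdPairs (fun a b => ~ torus_eq a b) L /\
  Forall (Qualifies E E' tau Dtau lam Rc n z v) L.

(** m = N(tau, R; n) = sup_z sup_v #{zeta in f^{-n}(z) : v in Df^n(zeta) K_R}
    (the sup is over natural numbers bounded by l^n, hence a maximum). *)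
Definition IsNcount (E E' tau Dtau : R -> R) (lam Rc : R) (n m : nat) : Prop :=
  (exists z v L, GoodList E E' tau Dtau lam Rc n z v L /\ length L = m) /\
  (forall z v L, GoodList E E' tau Dtau lam Rc n z v L -> (length L <= m)%nat).

(** N(tau) = L: for every R > ||tau'||_inf, N(tau,R;n)^{1/n} -> L as n -> oo
    (sequence indexed from n = 1). *)
Definition NLimit (E E' tau : R -> R) (lam : R) (Lim : R) : Prop :=
  forall Dtau : R -> R, (forall x, derivable_pt_lim tau x (Dtau x)) ->
  forall Rc : R, (forall x, Rabs (Dtau x) < Rc) ->
  exists a : nat -> nat,
    (forall n, IsNcount E E' tau Dtau lam Rc (S n) (a n)) /\
    Un_cv (fun n => Rpower (INR (a n)) (/ INR (S n))) Lim.

(* Main.v *)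
(* Let G be the inverse of the lift of E to the real line, so that the points of
   E^-n(x) are the G^n(x + b) mod 1 with 0 <= b < l^n. Then v lies in
   Df^n(zeta) K_R exactly when the slope s of v satisfies
   |s - S_n(x + b)| <= theta_R (G^n)'(x + b), where S_n is the derivative of
   sum_(1 <= k <= n) tau o G^k. So N(tau, R; n) is the maximal number, over x and
   s, of such hits b, and everything reduces to counting hits. Submultiplicativity
   and the independence of R follow from the invariance of the cones, and
   "N(tau, R; n) < rho^n for some R and n" is an open condition.

   Density is a moment argument. If N(tau, R; n) >= rho^n, then by pigeonhole some
   node of the tree of preimages has many children at distance q, each with about
   rho^(n/2) hits below it; among them one finds p whose orbits of length q do not
   come close to each other. Add to tau a finite-dimensional perturbation
   sum_c t_c phi(x - c/D), where phi' is concentrated near the integers: near these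
   p children the slopes depend on the parameters t_c through a diagonally dominant
   matrix, so that p given hits b_1, ..., b_p occur for a proportion
   O(prod_i (G^m)'(y_i)) of the parameters only. By bounded distortion
   sum_b (G^m)'(y + b) is bounded, so the p-th moment of the number of hits is
   bounded independently of n, and a given node is bad with probability
   O(rho^(-np/2)). For p large this beats the exponential number of nodes, once x
   and s are discretized with exponentially small mesh. *)
From HB Require Import structures.
Require Import Defs.
From Stdlib Require Import Reals Lra List Lia ZArith ClassicalEpsilon FunctionalExtensionality.
From mathcomp Require Import all_boot zify.
Open Scope R_scope.
Delimit Scope R_scope with Re.
Set Implicit Arguments.
Unset Strict Implicit.
Unset Printing Implicit Defensive.

Lemma INR_expn (a b : nat) : INR (a ^ b)%N = INR a ^ b.
Proof. by elim: b => [|b IH] //=; rewrite expnS mulnE mult_INR IH. Qed.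

Lemma INR_leq (a b : nat) : (a <= b)%N -> INR a <= INR b.
Proof. by move=> /leP; apply: le_INR. Qed.

Lemma Rabs_le_between (a b : R) : Rabs a <= b -> - b <= a <= b.
Proof. move=> h; split; have := Rle_abs a; have := Rle_abs (-a); rewrite Rabs_Ropp; lra. Qed.

Lemma Rabs_divp (a b : R) : 0 < b -> Rabs (a / b) = Rabs a / b.
Proof. by move=> h; rewrite /Rdiv Rabs_mult (Rabs_right (/ b)) //; left; apply: Rinv_0_lt_compat. Qed.

Lemma exp_le (x y : R) : x <= y -> exp x <= exp y.
Proof. by case=> [h|->]; [left; apply: exp_increasing | right]. Qed.

Lemma exp_ge1 (x : R) : 0 <= x -> 1 <= exp x.
Proof. by have := exp_ineq1_le x; lra. Qed.

(** * Inverse branches *)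
(** The upper bound [maxexp] of the derivative is a natural number, so that its
    powers can serve as numbers of grid points. *)
Record expanding_lift := ExpandingLift {
  Emap : R -> R;
  Eder : R -> R;
  Einv : R -> R;
  degree : nat;
  maxexp : nat;
  minexp : R;
  lipE1 : R;
  degree_ge2 : (2 <= degree)%N;
  Emap_der : forall x, derivable_pt_lim Emap x (Eder x);
  Emap_lift : CircleLift degree Emap;
  minexp_gt1 : 1 < minexp;
  Eder_ge : forall x, minexp <= Eder x;
  Eder_le : forall x, Eder x <= INR maxexp;
  lipE1_ge0 : 0 <= lipE1;
  Eder_lip : forall x y, Rabs (Eder x - Eder y) <= lipE1 * Rabs (x - y);
  Emap_inv : forall X, Emap (Einv X) = X }.

Section Branches.

Variable B : expanding_lift.
Local Notation E := (Emap B).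
Local Notation E1 := (Eder B).
Local Notation G := (Einv B).
Local Notation l := (degree B).
Local Notation Q := (maxexp B).
Local Notation lam := (minexp B).
Local Notation C2 := (lipE1 B).
Let lam_gt1 : 1 < lam := minexp_gt1 B.
Let C2_ge0 : 0 <= C2 := lipE1_ge0 B.
Local Notation E1_ge := (Eder_ge B).
Local Notation E1_le := (Eder_le B).

Lemma E1_gt1 x : 1 < E1 x.
Proof. have := E1_ge x; lra. Qed.

Lemma Q_gt1 : 1 < INR Q.
Proof. have := E1_ge 0; have := E1_le 0; lra. Qed.

Lemma E_mvt x y : x < y -> exists2 c, x < c < y & E y - E x = E1 c * (y - x).
Proof.
move=> xy; have pr z : derivable_pt E z by exists (E1 z); apply: (@Emap_der B).
have [c [hc1 hc2]] := MVT_cor1 E x y (fun z => pr z) xy.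
exists c => //; rewrite hc1; congr (_ * _).
by apply: (uniqueness_limite E c _ _ _ ((@Emap_der B) c)); apply: derive_pt_eq_1 (erefl _).
Qed.

Lemma E_strict x y : x < y -> E x < E y.
Proof. by move=> xy; have [c _ h] := E_mvt xy; have := E1_gt1 c; nra. Qed.

Lemma E_inj x y : E x = E y -> x = y.
Proof.
move=> h; case: (Rtotal_order x y) => [/E_strict|[//|/E_strict]]; lra.
Qed.

Lemma G_E x : G (E x) = x.
Proof. by apply: E_inj; rewrite (@Emap_inv B). Qed.

Lemma G_strict X Y : X < Y -> G X < G Y.
Proof.
move=> h; case: (Rlt_or_le (G X) (G Y)) => // -[/E_strict|/(f_equal E)]; rewrite !(@Emap_inv B); lra.
Qed.

Lemma G_mvt X Y : X < Y ->
  exists2 c, G X < c < G Y & Y - X = E1 c * (G Y - G X).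
Proof.
by move=> /G_strict /E_mvt [c hc h]; exists c => //; rewrite -h !(@Emap_inv B).
Qed.

Lemma G_contract X Y : lam * Rabs (G X - G Y) <= Rabs (X - Y).
Proof.
wlog h : X Y / X < Y => [W|].
  case: (Rtotal_order X Y) => [/W//|[->|/W]]; first by rewrite !Rminus_diag Rabs_R0; lra.
  by rewrite (Rabs_minus_sym X) (Rabs_minus_sym (G X)).
have [c _ hc] := G_mvt h; have hG := G_strict h; have := E1_ge c.
rewrite !Rabs_left; nra.
Qed.

Lemma E_expand x y : Rabs (E x - E y) <= INR Q * Rabs (x - y).
Proof.
wlog h : x y / x < y => [W|].
  case: (Rtotal_order x y) => [/W//|[->|/W]]; first by rewrite !Rminus_diag Rabs_R0; lra.
  by rewrite (Rabs_minus_sym x) (Rabs_minus_sym (E x)).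
have [c _ hc] := E_mvt h; have hG := E_strict h; have := E1_le c.
rewrite !Rabs_left; nra.
Qed.

Lemma G_lip X Y : Rabs (G X - G Y) <= Rabs (X - Y) / lam.
Proof. apply: (Rmult_le_reg_l lam); first lra. have := G_contract X Y. by rewrite Rmult_div_assoc Rmult_div_r; lra. Qed.

Lemma E_addZ x (z : Z) : E (x + IZR z) = E x + IZR z * INR l.
Proof.
have addn (n : nat) y : E (y + INR n) = E y + INR n * INR l.
  elim: n => [|n IH]; first by rewrite /= !Rplus_0_r Rmult_0_l Rplus_0_r.
  by rewrite S_INR -Rplus_assoc (@Emap_lift B) IH; ring.
case: (Z_le_gt_dec 0 z) => hz.
  by rewrite -(Z2Nat.id z hz) -INR_IZR_INZ addn.
have := addn (Z.to_nat (- z)) (x + IZR z).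
rewrite INR_IZR_INZ Z2Nat.id; last lia.
rewrite opp_IZR.
have -> : x + IZR z + - IZR z = x by ring.
lra.
Qed.

Lemma G_addZ X (z : Z) : G (X + IZR z * INR l) = G X + IZR z.
Proof. by apply: E_inj; rewrite (@Emap_inv B) E_addZ (@Emap_inv B). Qed.

Lemma E1_addZ x (z : Z) : E1 (x + IZR z) = E1 x.
Proof.
apply: (uniqueness_limite E (x + IZR z)); first exact: (@Emap_der B).
move=> eps he; have [d hd] := (@Emap_der B) x eps he; exists d => h h0 hh.
have := hd h h0 hh; have -> : x + IZR z + h = x + h + IZR z by ring.
rewrite !E_addZ.
by have -> : E (x + h) + IZR z * INR l - (E x + IZR z * INR l) = E (x+h) - E x by ring.
Qed.

Lemma iterG_addZ k X (z : Z) :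
  iter k G (X + IZR z * INR l ^ k) = iter k G X + IZR z.
Proof.
elim: k X => [|k IH] X; first by rewrite /= Rmult_1_r.
rewrite !iterSr.
have -> : IZR z * INR l ^ k.+1 = IZR (z * Z.of_nat (l ^ k)%N) * INR l.
  by rewrite mult_IZR -INR_IZR_INZ INR_expn /=; ring.
by rewrite G_addZ mult_IZR -INR_IZR_INZ INR_expn IH.
Qed.

Lemma iterE_addZ k x (z : Z) :
  iter k E (x + IZR z) = iter k E x + IZR z * INR l ^ k.
Proof.
elim: k x z => [|k IH] x z; first by rewrite /= Rmult_1_r.
rewrite !iterSr E_addZ INR_IZR_INZ -mult_IZR IH mult_IZR /=.
by rewrite -INR_IZR_INZ; ring.
Qed.

Lemma iterE_iterG k X : iter k E (iter k G X) = X.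
Proof. by elim: k X => [|k IH] X //; rewrite iterSr [iter k.+1 G X]iterS (@Emap_inv B) IH. Qed.

Lemma iterG_iterE k X : iter k G (iter k E X) = X.
Proof. by elim: k X => [|k IH] X //; rewrite iterSr [iter k.+1 E X]iterS G_E IH. Qed.

Lemma iterE_expand k x y :
  Rabs (iter k E x - iter k E y) <= INR Q ^ k * Rabs (x - y).
Proof.
elim: k => [|k IH] /=; first lra.
apply: Rle_trans (E_expand _ _) _; have := Q_gt1; nra.
Qed.

(** [dG k X] is the derivative of [iter k G] at [X]. *)
Fixpoint dG (k : nat) (X : R) : R :=
  if k is k'.+1 then dG k' (G X) / E1 (G X) else 1.

(** With [psi = tau'], [slopeG psi k X] is the derivative at [X] of
    [sum_(1 <= j <= k) tau (iter j G X)]. *)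
Fixpoint slopeG (psi : R -> R) (k : nat) (X : R) : R :=
  if k is k'.+1 then (psi (G X) + slopeG psi k' (G X)) / E1 (G X) else 0.

Lemma dG_gt0 k X : 0 < dG k X.
Proof.
elim: k X => [|k IH] X /=; first lra.
by apply: Rdiv_lt_0_compat; last have := E1_gt1 (G X); try lra.
Qed.

Lemma dG_add k m X : dG (k + m)%N X = dG k X * dG m (iter k G X).
Proof.
elim: k X => [|k IH] X; first by rewrite /= Rmult_1_l.
by rewrite addSn iterSr /= IH /Rdiv; ring.
Qed.

Lemma slopeG_add psi k m X :
  slopeG psi (k + m)%N X = slopeG psi k X + dG k X * slopeG psi m (iter k G X).
Proof.
elim: k X => [|k IH] X; first by rewrite add0n /=; ring.
by rewrite addSn iterSr /= IH /Rdiv; ring.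
Qed.

Lemma dG_le k X : dG k X <= / lam ^ k.
Proof.
elim: k X => [|k IH] X /=; first lra.
rewrite Rinv_mult; have := IH (G X); have := dG_gt0 k (G X).
have := E1_ge (G X) => h1 h2 h3.
have := Rinv_le_contravar lam (E1 (G X)) ltac:(lra) h1.
have : 0 < / E1 (G X) by apply: Rinv_0_lt_compat; lra.
rewrite /Rdiv; nra.
Qed.

Lemma dG_ge k X : / INR Q ^ k <= dG k X.
Proof.
elim: k X => [|k IH] X /=; first lra.
rewrite Rinv_mult; have := IH (G X).
have := E1_le (G X); have := E1_gt1 (G X); have hQ := Q_gt1 => h1 h2 h3.
have := Rinv_le_contravar (E1 (G X)) (INR Q) ltac:(lra) h2.
have : 0 < / INR Q by apply: Rinv_0_lt_compat; lra.
have : 0 < / INR Q ^ k by apply: Rinv_0_lt_compat; apply: pow_lt; lra.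
rewrite /Rdiv; nra.
Qed.

Lemma dG_le1 k X : dG k X <= 1.
Proof.
apply: Rle_trans (dG_le _ _) _; rewrite -Rinv_1.
by apply: Rinv_le_contravar; [lra | apply: pow_R1_Rle; lra].
Qed.

Lemma dG_per k X (z : Z) : dG k (X + IZR z * INR l ^ k) = dG k X.
Proof.
elim: k X z => [|k IH] X z //.
have -> : IZR z * INR l ^ k.+1 = IZR (z * Z.of_nat (l ^ k)%N) * INR l.
  by rewrite mult_IZR -INR_IZR_INZ INR_expn /=; ring.
by rewrite /= G_addZ E1_addZ mult_IZR -INR_IZR_INZ INR_expn IH.
Qed.

Lemma slopeG_per psi k X (z : Z) : (forall x (z : Z), psi (x + IZR z) = psi x) ->
  slopeG psi k (X + IZR z * INR l ^ k) = slopeG psi k X.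
Proof.
move=> hpsi; elim: k X z => [|k IH] X z //.
have -> : IZR z * INR l ^ k.+1 = IZR (z * Z.of_nat (l ^ k)%N) * INR l.
  by rewrite mult_IZR -INR_IZR_INZ INR_expn /=; ring.
by rewrite /= G_addZ E1_addZ hpsi mult_IZR -INR_IZR_INZ INR_expn IH.
Qed.

Lemma slopeG_cone psi A k X : (forall x, Rabs (psi x) <= A) ->
  Rabs (slopeG psi k X) + A / (lam - 1) * dG k X <= A / (lam - 1).
Proof.
move=> hA; set th := A / (lam - 1).
have hth : th * (lam - 1) = A by rewrite /th; field; lra.
have A0 : 0 <= A by have := hA 0; have := Rabs_pos (psi 0); lra.
elim: k X => [|k IH] X; first by rewrite /= Rabs_R0; lra.
rewrite /= Rabs_divp; last by have := E1_gt1 (G X); lra.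
have h1 := E1_ge (G X).
have -> : th * (dG k (G X) / E1 (G X)) = th * dG k (G X) / E1 (G X) by field; lra.
rewrite -Rdiv_plus_distr; apply: (Rmult_le_reg_l (E1 (G X))); first lra.
have -> : E1 (G X) * ((Rabs (psi (G X) + slopeG psi k (G X)) + th * dG k (G X)) / E1 (G X)) = Rabs (psi (G X) + slopeG psi k (G X)) + th * dG k (G X) by field; lra.
have := IH (G X); have := Rabs_triang (psi (G X)) (slopeG psi k (G X)); have := hA (G X).
have : 0 <= th by apply: (Rmult_le_reg_r (lam - 1)); lra.
nra.
Qed.

Lemma slopeG_bound psi A k X : (forall x, Rabs (psi x) <= A) ->
  Rabs (slopeG psi k X) <= A / (lam - 1).
Proof.
move=> hA; have := slopeG_cone k X hA; have := dG_gt0 k X.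
have A0 : 0 <= A by have := hA 0; have := Rabs_pos (psi 0); lra.
have : 0 <= A / (lam - 1) by apply: Rle_mult_inv_pos; lra.
nra.
Qed.

Lemma slopeG_lin psi phi c k X :
  slopeG (fun x => psi x + c * phi x) k X = slopeG psi k X + c * slopeG phi k X.
Proof.
elim: k X => [|k IH] X /=; first ring.
by rewrite IH /Rdiv; ring.
Qed.

Lemma slopeG_ext psi phi k X : (forall x, psi x = phi x) -> slopeG psi k X = slopeG phi k X.
Proof. by move=> h; elim: k X => [|k IH] X //=; rewrite h IH. Qed.

Definition dist_c := C2 / (lam - 1).

Lemma dist_c_ge0 : 0 <= dist_c.
Proof. by apply: Rle_mult_inv_pos; lra. Qed.

Lemma E1_ratio x y d : Rabs (x - y) <= d / lam -> E1 x <= E1 y * exp (C2 * d / lam).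
Proof.
move=> hd; have := (@Eder_lip B) x y; have := Rle_abs (E1 x - E1 y); have := E1_gt1 y => h1 h2 h3.
have h4 : C2 * Rabs (x - y) <= C2 * d / lam.
  by rewrite /Rdiv Rmult_assoc; apply: Rmult_le_compat_l.
have := exp_ineq1_le (C2 * d / lam).
have : 0 <= C2 * d / lam by apply: Rle_trans h4; have := Rabs_pos (x - y); nra.
set u := _ / lam in h4 *; nra.
Qed.

Lemma dist_split d : dist_c * d = C2 * d / lam + dist_c * (d / lam).
Proof. by rewrite /dist_c; field; lra. Qed.

Lemma dG_distort k X Y : dG k X <= dG k Y * exp (dist_c * Rabs (X - Y)).
Proof.
have h0 := dist_c_ge0.
elim: k X Y => [|k IH] X Y /=.
  by rewrite Rmult_1_l; apply: exp_ge1; have := Rabs_pos (X - Y); nra.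
have hX := E1_gt1 (G X); have hY := E1_gt1 (G Y).
rewrite dist_split exp_plus.
have hl := G_lip X Y.
have r1 := E1_ratio (d := Rabs (X - Y)) (x := G Y) (y := G X).
rewrite Rabs_minus_sym in hl; have {}r1 := r1 hl.
have r2 := IH (G X) (G Y).
have r3 : exp (dist_c * Rabs (G X - G Y)) <= exp (dist_c * (Rabs (X - Y) / lam)).
  by apply: exp_le; apply: Rmult_le_compat_l => //; rewrite Rabs_minus_sym.
set e1 := exp (C2 * _ / lam) in r1 *; set e2 := exp (dist_c * (_ / _)) in r3 *.
have d1 := dG_gt0 k (G X); have d2 := dG_gt0 k (G Y).
have e1p : 0 < e1 by apply: exp_pos.
apply: (Rmult_le_reg_l (E1 (G X))); first lra.
have -> : E1 (G X) * (dG k (G X) / E1 (G X)) = dG k (G X) by field; lra.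
have -> : E1 (G X) * (dG k (G Y) / E1 (G Y) * (e1 * e2)) = (dG k (G Y) * e2) * (E1 (G X) * e1 / E1 (G Y)) by field; lra.
have s1 : 1 <= E1 (G X) * e1 / E1 (G Y).
  apply: (Rmult_le_reg_r (E1 (G Y))); first lra.
  have -> : E1 (G X) * e1 / E1 (G Y) * E1 (G Y) = E1 (G X) * e1 by field; lra.
  lra.
have s2 : dG k (G X) <= dG k (G Y) * e2 by nra.
nra.
Qed.

Lemma iterG_gap k X Y : X < Y ->
  (Y - X) * dG k X <= (iter k G Y - iter k G X) * exp (dist_c * (Y - X)).
Proof.
have h0 := dist_c_ge0.
elim: k X Y => [|k IH] X Y hXY.
  by rewrite /=; have := exp_ge1 (x := dist_c * (Y - X)); nra.
rewrite !iterSr /=; have hG := G_strict hXY.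
have [c hc1 hc2] := G_mvt hXY; have {}IH := IH _ _ hG.
have hX := E1_gt1 (G X); have hc := E1_gt1 c.
have hl := G_lip Y X.
rewrite !(Rabs_right (_ - _)) in hl; try lra.
have r1 := E1_ratio (d := Y - X) (x := c) (y := G X).
rewrite Rabs_right in r1; last lra.
have {}r1 : E1 c <= E1 (G X) * exp (C2 * (Y - X) / lam) by apply: r1; lra.
have r3 : exp (dist_c * (G Y - G X)) <= exp (dist_c * ((Y - X) / lam)).
  by apply: exp_le; apply: Rmult_le_compat_l.
rewrite dist_split exp_plus.
set e1 := exp (C2 * _ / lam) in r1 *; set e2 := exp (dist_c * (_ / _)) in r3 *.
have d1 := dG_gt0 k (G X).
have e1p : 0 < e1 by apply: exp_pos.
apply: (Rmult_le_reg_l (E1 (G X))); first lra.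
have -> : E1 (G X) * ((Y - X) * (dG k (G X) / E1 (G X))) = (Y - X) * dG k (G X) by field; lra.
rewrite hc2.
set dg := iter k G (G Y) - iter k G (G X) in IH *.
have dg0 : 0 <= dg.
  have ep : 0 < exp (dist_c * (G Y - G X)) by apply: exp_pos.
  by apply: (Rmult_le_reg_r _ _ _ ep); nra.
have s : (G Y - G X) * dG k (G X) <= dg * e2 by nra.
have : 0 <= (G Y - G X) * dG k (G X) by nra.
nra.
Qed.

Definition Cdist := exp dist_c.

Lemma Cdist_ge1 : 1 <= Cdist.
Proof. exact: exp_ge1 dist_c_ge0. Qed.

Lemma dG_unit_gap k X : dG k X <= Cdist * (iter k G (X + 1) - iter k G X).
Proof.
have := @iterG_gap k X (X + 1) ltac:(lra).
have -> : X + 1 - X = 1 by ring.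
by rewrite /Cdist Rmult_1_r; lra.
Qed.

Definition lipS (A L : R) := (L + (A + A / (lam - 1)) * C2) / (lam - 1).

Lemma slopeG_lip psi A L k X Y :
  (forall x, Rabs (psi x) <= A) ->
  (forall x y, Rabs (psi x - psi y) <= L * Rabs (x - y)) ->
  Rabs (slopeG psi k X - slopeG psi k Y) <= lipS A L * Rabs (X - Y).
Proof.
move=> hA hL.
have A0 : 0 <= A by have := hA 0; have := Rabs_pos (psi 0); lra.
have L0 : 0 <= L by have := hL 1 0; rewrite Rminus_0_r Rabs_R1; have := Rabs_pos (psi 1 - psi 0); lra.
set A1 := A + A / (lam - 1).
have A10 : 0 <= A1 by have : 0 <= A / (lam - 1) by [apply: Rle_mult_inv_pos; lra]; rewrite /A1; lra.
have K0 : 0 <= lipS A L by apply: Rle_mult_inv_pos; rewrite -/A1; nra.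
have KE : lipS A L * (lam - 1) = L + A1 * C2 by rewrite /lipS /A1; field; lra.
elim: k X Y => [|k IH] X Y.
  by rewrite /= Rminus_diag Rabs_R0; have := Rabs_pos (X - Y); nra.
rewrite /=.
set x := G X; set y := G Y.
have hX := E1_ge x; have hY := E1_ge y.
set a := psi x + slopeG psi k x; set b := psi y + slopeG psi k y.
have -> : a / E1 x - b / E1 y = ((a - b) + (b / E1 y) * (E1 y - E1 x)) / E1 x by field; lra.
have hd := G_contract X Y; rewrite -/x -/y in hd.
have hab : Rabs (a - b) <= (L + lipS A L) * Rabs (x - y).
  have -> : a - b = (psi x - psi y) + (slopeG psi k x - slopeG psi k y) by rewrite /a /b; ring.
  by apply: Rle_trans (Rabs_triang _ _) _; have := hL x y; have := IH x y; lra.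
have hb : Rabs b <= A1.
  apply: Rle_trans (Rabs_triang _ _) _; have := hA y; have := slopeG_bound k y hA; rewrite /A1; lra.
have hb' : Rabs (b / E1 y) <= A1.
  rewrite Rabs_divp; last lra.
  apply: (Rmult_le_reg_r (E1 y)); first lra.
  have -> : Rabs b / E1 y * E1 y = Rabs b by field; lra.
  nra.
have he := (@Eder_lip B) y x; rewrite (Rabs_minus_sym y) in he.
have hn : Rabs ((a - b) + (b / E1 y) * (E1 y - E1 x)) <= (L + lipS A L + A1 * C2) * Rabs (x - y).
  apply: Rle_trans (Rabs_triang _ _) _; rewrite Rabs_mult.
  have := Rabs_pos (b / E1 y); have := Rabs_pos (E1 y - E1 x) => p1 p2.
  have : Rabs (b / E1 y) * Rabs (E1 y - E1 x) <= A1 * (C2 * Rabs (x - y)) by apply: Rmult_le_compat.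
  nra.
rewrite Rabs_divp; last lra.
apply: (Rmult_le_reg_r (E1 x)); first lra.
have -> : forall u, u / E1 x * E1 x = u by move=> u; field; lra.
apply: Rle_trans hn _.
have -> : L + lipS A L + A1 * C2 = lam * lipS A L by rewrite /lipS /A1; field; lra.
have := Rabs_pos (x - y); have := Rabs_pos (X - Y) => p1 p2.
have : lam * lipS A L * Rabs (x - y) <= lipS A L * Rabs (X - Y) by nra.
have : 0 <= lipS A L * Rabs (X - Y) by nra.
nra.
Qed.

End Branches.

Definition Rleb (a b : R) : bool := if Rle_dec a b then true else false.

Lemma RlebP a b : reflect (a <= b) (Rleb a b).
Proof. by rewrite /Rleb; case: Rle_dec => h; constructor. Qed.

Lemma sum_ord_mul (m n : nat) (F : nat -> nat) :
  (\sum_(i < m * n) F i = \sum_(a < m) \sum_(b < n) F (a + b * m))%N.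
Proof.
elim: n => [|n IH].
  by rewrite muln0 big_ord0 big1 // => a _; rewrite big_ord0.
rewrite mulnS addnC big_split_ord /= IH.
rewrite [RHS](eq_bigr (fun a : 'I_m => \sum_(b < n) F (a + b * m) + F (a + n * m))%N); last first.
  by move=> a _; rewrite big_ord_recr.
rewrite big_split /=; congr addn; apply: eq_bigr => a _; congr F; lia.
Qed.

Lemma Periodic1_Z (T : Type) (psi : R -> T) : (forall x, psi (x + 1) = psi x) -> forall x (z : Z), psi (x + IZR z) = psi x.
Proof.
move=> hp x z.
have addn (n : nat) y : psi (y + INR n) = psi y.
  elim: n => [|n IH]; first by rewrite /= Rplus_0_r.
  by rewrite S_INR -Rplus_assoc hp.
case: (Z_le_gt_dec 0 z) => hz.
  by rewrite -(Z2Nat.id z hz) -INR_IZR_INZ addn.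
have := addn (Z.to_nat (- z)) (x + IZR z).
rewrite INR_IZR_INZ Z2Nat.id; last lia.
rewrite opp_IZR.
by have -> : x + IZR z + - IZR z = x by ring.
Qed.

(** * Counting hits *)
Section Hits.

Variable B : expanding_lift.
Local Notation E := (Emap B).
Local Notation E1 := (Eder B).
Local Notation G := (Einv B).
Local Notation l := (degree B).
Local Notation Q := (maxexp B).
Local Notation lam := (minexp B).
Local Notation dG := (dG B).
Local Notation slopeG := (slopeG B).

Definition hit psi th n s X := Rleb (Rabs (s - slopeG psi n X)) (th * dG n X).

(** The points [x + b], [b < l ^ n], run over the [l ^ n] preimages of [x mod 1]
    under the [n]-th iterate, each preimage being [iter n G (x + b) mod 1]. *)
Definition hits psi th n x s : nat := (\sum_(b < l ^ n) hit psi th n s (x + INR b))%N.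

Lemma hits_le psi th n x s : (hits psi th n x s <= l ^ n)%N.
Proof.
rewrite /hits -[X in (_ <= X)%N]card_ord -sum1_card.
by apply: leq_sum => i _; case: hit.
Qed.

Lemma hits_mono psi psi' th th' n m x s s' d :
  n = m -> (forall b : nat, hit psi th n s (x + INR b) -> hit psi' th' m s' (x + d + INR b)) ->
  (hits psi th n x s <= hits psi' th' m (x + d) s')%N.
Proof.
by move=> -> h; apply: leq_sum => b _; case e: hit; rewrite // h.
Qed.

Lemma degree_pow_gt0 n : (0 < l ^ n)%N.
Proof. by rewrite expn_gt0; have := degree_ge2 B; case: l. Qed.

Lemma hits_pos psi th n x : 0 <= th -> (0 < hits psi th n x (slopeG psi n x))%N.
Proof.
move=> th0; have := degree_pow_gt0 n; rewrite /hits.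
case: (l ^ n)%N => // N _; rewrite big_ord_recl /= Rplus_0_r.
suff -> : hit psi th n (slopeG psi n x) x by [].
apply/RlebP; rewrite Rminus_diag Rabs_R0; have := dG_gt0 B n x; nra.
Qed.

Section Periodic.
Variables (psi : R -> R) (th : R).
Hypothesis psiZ : forall x (z : Z), psi (x + IZR z) = psi x.

Lemma hit_per n s X (z : Z) :
  hit psi th n s (X + IZR z * INR l ^ n) = hit psi th n s X.
Proof. by rewrite /hit slopeG_per // dG_per. Qed.

Lemma hit_add n m s Y (b : nat) :
  hit psi th (n + m) s (Y + INR b * INR l ^ n) =
  hit psi th m ((s - slopeG psi n Y) / dG n Y) (iter n G Y + INR b).
Proof.
rewrite /hit slopeG_add dG_add INR_IZR_INZ slopeG_per // dG_per iterG_addZ.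
set D := dG n Y; have hD : 0 < D by apply: dG_gt0.
set X := iter _ _ _ + _.
have -> : s - (slopeG psi n Y + D * slopeG psi m X) =
  D * ((s - slopeG psi n Y) / D - slopeG psi m X) by field; lra.
rewrite Rabs_mult (Rabs_right D); last lra.
by apply/RlebP/RlebP; nra.
Qed.

Lemma hits_split n m x s :
  hits psi th (n + m) x s =
  (\sum_(a < l ^ n) \sum_(b < l ^ m) hit psi th (n + m) s (x + INR a + INR b * INR l ^ n))%N.
Proof.
rewrite /hits expnD (sum_ord_mul _ _ (fun i => nat_of_bool (hit psi th (n + m) s (x + INR i)))); apply: eq_bigr => a _; apply: eq_bigr => b _.
by rewrite plus_INR mult_INR INR_expn Rplus_assoc.
Qed.

Lemma hits_shift n x s (z : Z) : hits psi th n (x + IZR z) s = hits psi th n x s.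
Proof.
have step y : hits psi th n (y + 1) s = hits psi th n y s.
  rewrite /hits; have := degree_pow_gt0 n.
  have := hit_per n s y 1; rewrite Rmult_1_l -INR_expn.
  case: (l ^ n)%N => // N hN _.
  rewrite big_ord_recr [RHS]big_ord_recl [LHS]addnC; congr addn.
    have -> : y + 1 + INR N = y + INR N.+1 by rewrite S_INR; ring.
    by rewrite hN Rplus_0_r.
  apply: eq_bigr => b _; rewrite lift0.
  by have -> : y + 1 + INR b = y + INR b.+1 by rewrite S_INR; ring.
exact: (Periodic1_Z (psi := fun y => hits psi th n y s)).
Qed.

Lemma hits_add_le th1 n m M x s :
  (forall Y, Rabs (slopeG psi m Y) + th * dG m Y <= th1) ->
  (forall y t, (hits psi th m y t <= M)%N) ->
  (hits psi th (n + m) x s <= hits psi th1 n x s * M)%N.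
Proof.
move=> hc hM; rewrite hits_split /hits big_distrl /=; apply: leq_sum => a _.
have [h1|h1] := boolP (hit psi th1 n s (x + INR a)).
  rewrite mul1n; apply: leq_trans (hM (iter n G (x + INR a)) ((s - slopeG psi n (x + INR a)) / dG n (x + INR a))).
  by apply: leq_sum => b _; rewrite hit_add.
rewrite mul0n leqn0 big1 // => b _; rewrite hit_add.
case: (boolP (hit _ _ m _ _)) => // /RlebP; set Y := iter n G _ + _ => h2.
case/RlebP: h1; have := hc Y; have hD := dG_gt0 B n (x + INR a).
set D := dG n _ in h2 hD *; set t := _ / D in h2 *.
have -> : s - slopeG psi n (x + INR a) = D * t by rewrite /t; field; lra.
rewrite Rabs_mult (Rabs_right D); last lra.
have := Rabs_triang (t - slopeG psi m Y) (slopeG psi m Y).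
have -> : t - slopeG psi m Y + slopeG psi m Y = t by ring.
nra.
Qed.

End Periodic.

End Hits.

Lemma sum_bool_size (N : nat) (p : nat -> bool) :
  (\sum_(b < N) p b)%N = size (filter p (iota 0 N)).
Proof.
rewrite -sum1_size big_filter -(big_mkord xpredT (fun b => nat_of_bool (p b))).
rewrite /index_iota subn0 [RHS]big_mkcond; apply: eq_bigr => i _.
by case: (p i).
Qed.

Lemma length_le_sum_bool (T : Type) (L : list T) (f : T -> nat) (N : nat) (p : nat -> bool) :
  Forall (fun t => (f t < N)%N && p (f t)) L ->
  ForallOrdPairs (fun a b => f a <> f b) L ->
  (length L <= \sum_(b < N) p b)%N.
Proof.
move=> h1 h2; rewrite sum_bool_size.
have -> : length L = size (map f L) by rewrite size_map.
apply: uniq_leq_size.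
  elim: h2 {h1} => //= a t h _ ->; rewrite andbT; apply/negP.
  elim: h => //= b t' hb _ IH; rewrite inE => /orP[/eqP|] //.
elim: h1 => //= a t /andP[ha hp] _ IH x; rewrite inE => /orP[/eqP ->|/IH //].
by rewrite mem_filter hp mem_iota add0n.
Qed.

Lemma ForallOrdPairs_weaken (T : Type) (P : T -> Prop) (R1 R2 : T -> T -> Prop) (L : list T) :
  (forall a b, P a -> P b -> R1 a b -> R2 a b) ->
  Forall P L -> ForallOrdPairs R1 L -> ForallOrdPairs R2 L.
Proof.
move=> h hP hL; elim: hL hP => [|a t ha _ IH] hP; first by constructor.
inversion_clear hP; constructor; last exact: IH.
elim: ha H0 {IH} => //= b t' hb _ IH H0; inversion_clear H0; constructor; last exact: IH.
exact: h.
Qed.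

Lemma ForallOrdPairs_map_uniq (T : Type) (R1 : T -> T -> Prop) (f : nat -> T) (s : list nat) :
  uniq s -> (forall a b, a \in s -> b \in s -> a <> b -> R1 (f a) (f b)) ->
  ForallOrdPairs R1 (map f s).
Proof.
elim: s => [|a s IH] /=; first by constructor.
case/andP => ha hs h; constructor; last first.
  by apply: IH => // b c hb hc; apply: h; rewrite inE ?hb ?hc orbT.
have : forall b, b \in s -> R1 (f a) (f b).
  move=> b hb; apply: h; rewrite ?inE ?eqxx ?hb ?orbT //.
  by move=> e; move: ha; rewrite e hb.
elim: s {ha hs h IH} => [|b s IH] h /=; constructor.
  by apply: h; rewrite inE eqxx.
by apply: IH => c hc; apply: h; rewrite inE hc orbT.
Qed.

Lemma Forall_map_mem (T : Type) (P : T -> Prop) (f : nat -> T) (s : list nat) :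
  (forall a, a \in s -> P (f a)) -> Forall P (map f s).
Proof.
elim: s => [|a s IH] h /=; constructor; first by apply: h; rewrite inE eqxx.
by apply: IH => b hb; apply: h; rewrite inE hb orbT.
Qed.

Lemma exists_max_nat (P : nat -> Prop) (N : nat) :
  (exists n, P n) -> (forall n, P n -> (n <= N)%N) ->
  exists n, P n /\ forall m, P m -> (m <= n)%N.
Proof.
elim: N P => [|N IH] P [n hn] hN.
  by exists n; split=> // m /hN; lia.
case: (Classical_Prop.classic (P N.+1)) => h; first by exists N.+1.
apply: IH; first by exists n.
move=> m hm; have := hN m hm; rewrite leq_eqVlt => /orP[/eqP e|//].
by move: hm; rewrite e.
Qed.

Lemma IZR_neq_between (z : Z) (N a b : nat) : (a < N)%N -> (b < N)%N ->
  INR a - INR b = IZR z * INR N -> a = b.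
Proof.
rewrite !INR_IZR_INZ -mult_IZR -minus_IZR => ha hb /eq_IZR h.
have z0 : z = 0%Z.
  case: (Z.lt_trichotomy z 0) => [hz|[//|hz]].
    have : (z * Z.of_nat N <= - Z.of_nat N)%Z by nia.
    lia.
  have : (Z.of_nat N <= z * Z.of_nat N)%Z by nia.
  lia.
by move: h; rewrite z0; lia.
Qed.

Section Link.

Variable B : expanding_lift.
Local Notation E := (Emap B).
Local Notation E1 := (Eder B).
Local Notation G := (Einv B).
Local Notation l := (degree B).
Local Notation Q := (maxexp B).
Local Notation lam := (minexp B).
Local Notation dG := (dG B).
Local Notation slopeG := (slopeG B).

Fixpoint birkhoff (tau : R -> R) (n : nat) (x : R) : R :=
  if n is n'.+1 then tau x + birkhoff tau n' (E x) else 0.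

Lemma FiterE tau n p : Fiter E tau n p = (iter n E p.1, p.2 + birkhoff tau n p.1).
Proof.
elim: n p => [|n IH] [x s] /=; first by rewrite Rplus_0_r.
by rewrite IH /= -iterSr Rplus_assoc.
Qed.

Lemma birkhoff_addZ tau n x (z : Z) : (forall x (z : Z), tau (x + IZR z) = tau x) ->
  birkhoff tau n (x + IZR z) = birkhoff tau n x.
Proof.
move=> ht; elim: n x z => [|n IH] x z //=.
by rewrite ht E_addZ INR_IZR_INZ -mult_IZR IH.
Qed.

Lemma DfnE psi n x w :
  (Dfn E E1 psi n x w).1 * dG n (iter n E x) = w.1 /\
  (Dfn E E1 psi n x w).2 = w.2 + slopeG psi n (iter n E x) * (Dfn E E1 psi n x w).1.
Proof.
elim: n x w => [|n IH] x w; first by rewrite /= Rmult_1_r Rmult_0_l Rplus_0_r.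
rewrite iterSr [Dfn _ _ _ _ _ _]/=.
move: (IH (E x) (E1 x * w.1, psi x * w.1 + w.2)).
set V := Dfn _ _ _ _ _ _; set X := iter n E (E x) => -[h1 h2]; rewrite /= in h1 h2.
rewrite -addn1 dG_add slopeG_add iterG_iterE /= G_E Rplus_0_r.
have hE := E1_gt1 B x.
split.
  have -> : V.1 * (dG n X * (1 / E1 x)) = (V.1 * dG n X) / E1 x by field; lra.
  by rewrite h1; field; lra.
rewrite h2.
have -> : (slopeG psi n X + dG n X * (psi x / E1 x)) * V.1 = slopeG psi n X * V.1 + (V.1 * dG n X) * psi x / E1 x by field; lra.
by rewrite h1; field; lra.
Qed.

Definition is_max_hits psi th n m :=
  (exists x s, hits B psi th n x s = m) /\ forall x s, (hits B psi th n x s <= m)%N.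

Lemma exists_max_hits psi th n : exists m, is_max_hits psi th n m.
Proof.
have [||m [h1 h2]] := @exists_max_nat (fun m => exists x s, hits B psi th n x s = m) (l ^ n)%N.
- by exists (hits B psi th n 0 0); exists 0; exists 0.
- by move=> m [x [s <-]]; apply: hits_le.
by exists m; split=> // x s; apply: h2; exists x; exists s.
Qed.

Lemma UnitVec_hit v : UnitVec v -> v.1 = 0 -> v.2 <> 0.
Proof. by rewrite /UnitVec /= => h h1 h2; move: h; rewrite h1 h2; lra. Qed.

Lemma GoodList_length tau psi Rc n z v L :
  (forall x (z : Z), tau (x + IZR z) = tau x) ->
  (forall x (z : Z), psi (x + IZR z) = psi x) ->
  GoodList E E1 tau psi lam Rc n z v L ->
  (length L <= hits B psi (Rc / (lam - 1)) n z.1 (v.2 / v.1))%N.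
Proof.
set th := Rc / (lam - 1).
move=> htau hpsi [hv [hL hQ]].
pose k (a : R * R) := Int_part (iter n E a.1 - z.1).
pose f a := Z.to_nat (Z.modulo (k a) (Z.of_nat (l ^ n))).
have hN := degree_pow_gt0 B n.
have kE a : torus_eq (Fiter E tau n a) z -> iter n E a.1 = z.1 + IZR (k a).
  rewrite FiterE => -[[c /= hc] _]; suff -> : k a = c by lra.
  rewrite /k hc; have [h1 h2] := base_Int_part (IZR c).
  have a1 := le_IZR _ _ h1.
  have a2 : (c < Int_part (IZR c) + 1)%Z by apply: lt_IZR; rewrite plus_IZR; lra.
  lia.
have fE a : INR (f a) = IZR (k a) - IZR (k a / Z.of_nat (l ^ n)) * INR l ^ n.
  rewrite /f -INR_expn !INR_IZR_INZ Z2Nat.id; last by have := Z.mod_pos_bound (k a) (Z.of_nat (l ^ n)); lia.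
  rewrite -mult_IZR -minus_IZR; congr IZR; rewrite Z.mod_eq; lia.
apply: (@length_le_sum_bool _ L f _ (fun b => hit B psi th n (v.2 / v.1) (z.1 + INR b))).
- elim: hQ => //= a t [ht [w [hw1 hw2]]] _ IH; constructor=> //; apply/andP; split.
    by rewrite /f; have := Z.mod_pos_bound (k a) (Z.of_nat (l ^ n)); lia.
  rewrite fE /Rminus Ropp_mult_distr_l -opp_IZR -Rplus_assoc.
rewrite hit_per // -kE //.
  have := DfnE psi n a.1 w; rewrite hw2; set X := iter _ _ _ => -[h1 h2].
  have hD := dG_gt0 B n X.
  have v0 : v.1 <> 0.
    move=> v0; have := UnitVec_hit hv v0; rewrite h2 v0 Rmult_0_r Rplus_0_r.
    move: h1; rewrite v0 Rmult_0_l => h1; move: hw1; rewrite /InCone.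
    by rewrite -[fst w]/(w.1) -h1 Rabs_R0 Rmult_0_r => hw; case: (Rcase_abs (w.2)) => hc; [move: hw; rewrite Rabs_left // | move: hw; rewrite Rabs_right //]; change (snd w) with w.2; lra.
  apply/RlebP; have -> : v.2 / v.1 - slopeG psi n X = w.2 / v.1 by rewrite h2; field.
  have v1 : 0 < Rabs v.1 by apply: Rabs_pos_lt.
  rewrite /Rdiv Rabs_mult Rabs_inv; apply: (Rmult_le_reg_r (Rabs v.1)) => //.
  rewrite Rmult_assoc Rinv_l; last lra.
  rewrite Rmult_1_r; apply: Rle_trans hw1 _.
  by rewrite -[fst w]/(w.1) -h1 Rabs_mult (Rabs_right (dG n X)); [right; rewrite /th /Rdiv; ring | lra].
apply: (ForallOrdPairs_weaken _ hQ hL) => a b [ha _] [hb _] hab e; apply: hab.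
have hka := kE _ ha; have hkb := kE _ hb.
have [c hc] : exists c : Z, a.1 = b.1 + IZR c.
  exists (k a / Z.of_nat (l ^ n) - k b / Z.of_nat (l ^ n))%Z.
  rewrite -(iterG_iterE B n a.1) -(iterG_iterE B n b.1) hka hkb -iterG_addZ; congr iter.
  have := fE a; rewrite e fE minus_IZR; lra.
split; first by exists c; change (fst a) with a.1; change (fst b) with b.1; lra.
move: ha hb; rewrite !FiterE /torus_eq /= => -[_ [i hi]] [_ [j hj]].
exists (i - j)%Z; rewrite minus_IZR.
move: hi; rewrite -[fst a]/(a.1) hc birkhoff_addZ //.
by rewrite -[fst b]/(b.1) in hj *; change (snd a) with a.2; change (snd b) with b.2; lra.
Qed.

Lemma GoodList_exists tau psi Rc n x s :
  exists z v L, GoodList E E1 tau psi lam Rc n z v L /\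
    length L = hits B psi (Rc / (lam - 1)) n x s.
Proof.
set th := Rc / (lam - 1).
set c := / sqrt (1 + s ^ 2).
have h0 : 0 < 1 + s ^ 2 by nra.
have hs : 0 < sqrt (1 + s ^ 2) by apply: sqrt_lt_R0.
have c0 : 0 < c by apply: Rinv_0_lt_compat.
have c1 : c ^ 2 * (1 + s ^ 2) = 1.
  rewrite /c -{2}(sqrt_sqrt (1 + s ^ 2)); last lra.
  by field; lra.
pose y (b : nat) := iter n G (x + INR b).
pose zt (b : nat) := (y b, - birkhoff tau n (y b)).
exists (x, 0), (c, s * c), (map zt (filter (fun b : nat => hit B psi th n s (x + INR b)) (iota 0 (l ^ n)))).
split; last by rewrite -[length _]/(size _) size_map /hits (sum_bool_size _ (fun b => hit B psi th n s (x + INR b))).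
split; first by rewrite /UnitVec /=; rewrite /= in c1; lra.
split.
  apply: ForallOrdPairs_map_uniq; first by rewrite filter_uniq // iota_uniq.
  move=> a b; rewrite !mem_filter !mem_iota !add0n => /andP[_ ha] /andP[_ hb] hab.
  case=> /= -[z hz] _; apply: hab; apply: (@IZR_neq_between z (l ^ n)) => //.
  have e : y a = y b + IZR z by lra.
  have := f_equal (iter n E) e; rewrite iterE_addZ /y !iterE_iterG INR_expn; lra.
apply: Forall_map_mem => b; rewrite mem_filter => /andP[/RlebP hb _]; split.
  rewrite FiterE /= /y iterE_iterG; split; rewrite /=.
    by exists (Z.of_nat b); rewrite -INR_IZR_INZ; lra.
  by exists 0%Z; lra.
set X := x + INR b in hb.
have hD := dG_gt0 B n X.
exists (c * dG n X, s * c - slopeG psi n X * c); split.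
  rewrite /InCone /= -/th.
  have -> : s * c - slopeG psi n X * c = (s - slopeG psi n X) * c by ring.
  rewrite !Rabs_mult (Rabs_right c); last lra.
  rewrite (Rabs_right (dG n X)); last lra.
  nra.
rewrite /= /y -/X; set w := (_, _).
have := DfnE psi n (iter n G X) w; rewrite iterE_iterG; case: Dfn => V1 V2 /= [h1 h2].
have e1 : V1 = c by nra.
by rewrite h2 e1; congr pair; ring.
Qed.

Lemma IsNcount_max_hits tau psi Rc n m :
  (forall x (z : Z), tau (x + IZR z) = tau x) ->
  (forall x (z : Z), psi (x + IZR z) = psi x) ->
  is_max_hits psi (Rc / (lam - 1)) n m -> IsNcount E E1 tau psi lam Rc n m.
Proof.
move=> ht hp [[x [s hxs]] hm]; split.
  by have [z [v [L [hL1 hL2]]]] := GoodList_exists tau psi Rc n x s; exists z, v, L; rewrite hL2.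
move=> z v L hL; apply/leP; apply: leq_trans (hm z.1 (v.2 / v.1)).
exact: GoodList_length hL.
Qed.

End Link.

(** * Subadditive growth *)

Definition is_rate (u : nat -> R) (L : R) : Prop :=
  (forall n, L * INR n <= u n) /\
  (forall e, 0 < e -> exists2 n, (0 < n)%N & u n < (L + e) * INR n).

Section Subadditive.
Variable u : nat -> R.
Hypothesis u_ge0 : forall n, 0 <= u n.
Hypothesis u0 : u 0%N = 0.
Hypothesis u_sub : forall n m, u (n + m)%N <= u n + u m.

Lemma subadditive_mul k n : u (k * n)%N <= INR k * u n.
Proof.
elim: k => [|k IH]; first by rewrite mul0n u0 /=; lra.
by rewrite mulSn S_INR; have := u_sub n (k * n); lra.
Qed.

Lemma is_rate_exists : exists2 L, 0 <= L & is_rate u L.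
Proof.
pose S x := exists2 n, (0 < n)%N & x = - (u n / INR n).
have hS n : (0 < n)%N -> 0 < INR n by move=> h; apply: lt_0_INR; lia.
have [m [hm1 hm2]] : {m | is_lub S m}.
  apply: completeness; last by exists (- (u 1 / INR 1)); exists 1%N.
  exists 0 => x [n hn ->]; have := hS n hn => h.
  have : 0 <= u n / INR n by apply: Rle_mult_inv_pos.
  lra.
exists (- m).
  suff : m <= 0 by lra.
  apply: hm2 => x [n hn ->].
  have : 0 <= u n / INR n by apply: Rle_mult_inv_pos => //; apply: hS.
  lra.
split=> [n|e he].
  case: (posnP n) => [->|hn]; first by rewrite u0 /=; lra.
  have := hm1 (- (u n / INR n)) (ex_intro2 _ _ n hn erefl).
  have h := hS n hn => h1; apply: (Rmult_le_reg_r (/ INR n)); first exact: Rinv_0_lt_compat.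
  by rewrite Rmult_assoc Rinv_r; rewrite /Rdiv in h1; lra.
apply: Classical_Prop.NNPP => hn.
suff : m <= m - e by lra.
apply: hm2 => x [n h ->].
case: (Rle_or_lt (- (u n / INR n)) (m - e)) => // hlt; case: hn; exists n => //.
have h0 := hS n h.
have -> : u n = (u n / INR n) * INR n by field; lra.
nra.
Qed.

Lemma is_rate_cv L : is_rate u L -> Un_cv (fun n => / INR n.+1 * u n.+1) L.
Proof.
move=> [h1 h2] e he.
have [n0 hn0 hu] := h2 (e / 2) ltac:(lra).
have [N hN] := INR_unbounded (2 * INR n0 * u 1%N / e + 1).
exists N => n hn; rewrite /R_dist; set m := n.+1.
have hm : 0 < INR m by apply: lt_0_INR; lia.
have i1 := Rinv_0_lt_compat _ hm.
have r1 := h1 m.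
have L1 : L <= / INR m * u m.
  apply: (Rmult_le_reg_l (INR m)) => //; rewrite -Rmult_assoc Rinv_r; lra.
rewrite Rabs_right; last lra.
suff : u m < (L + e) * INR m.
  move=> h; have : / INR m * u m < L + e; last lra.
  by apply: (Rmult_lt_reg_l (INR m)) => //; rewrite -Rmult_assoc Rinv_r; lra.
have em := divn_eq m n0.
have r2 := u_sub (m %/ n0 * n0) (m %% n0); rewrite -em in r2.
have r3 := subadditive_mul (m %/ n0) n0.
have r4 := subadditive_mul (m %% n0) 1; rewrite muln1 in r4.
have r5 : INR (m %% n0) <= INR n0 by apply: INR_leq; rewrite ltnW // ltn_mod.
have r6 : INR m = INR (m %/ n0) * INR n0 + INR (m %% n0) by rewrite {1}em plus_INR mult_INR.
have k0 := pos_INR (m %/ n0). have k1 := pos_INR (m %% n0).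
have n0p := pos_INR n0.
have u1 := u_ge0 1.
have L0 : 0 <= L + e / 2.
  apply: Rnot_lt_le => hl; have := u_ge0 n0; have : 0 < INR n0 by apply: lt_0_INR; lia.
  nra.
have hmN : INR N <= INR m by apply: INR_leq; rewrite /m; lia.
have hb : 2 * INR n0 * u 1%N < e * INR m.
  have : 2 * INR n0 * u 1%N / e < INR m by lra.
  move=> /(Rmult_lt_compat_r e _ _ he); have -> : 2 * INR n0 * u 1%N / e * e = 2 * INR n0 * u 1%N by field; lra.
  lra.
have s1 : INR (m %/ n0) * u n0 <= INR (m %/ n0) * ((L + e / 2) * INR n0) by nra.
have s2 : INR (m %% n0) * u 1%N <= INR n0 * u 1%N by nra.
nra.
Qed.

End Subadditive.

Lemma is_rate_le (u u' : nat -> R) (L L' c : R) (m : nat) :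
  (forall n k, u (n + k)%N <= u n + u k) -> u 0%N = 0 ->
  is_rate u L -> is_rate u' L' ->
  (forall n, u' (n + m)%N <= c + u n) -> L' <= L.
Proof.
move=> hsub h0 [_ h2] [h1' _] hc.
apply: Rnot_lt_le => hlt; set e := (L' - L) / 2.
have [n0 hn0 hu] := h2 e ltac:(rewrite /e; lra).
have n1 : 1 <= INR n0 by apply: (INR_leq (a := 1)).
have [k hk] := INR_unbounded ((c - L' * INR m) / e).
have := hc (k * n0)%N; have := subadditive_mul h0 hsub k n0; have := h1' (k * n0 + m)%N.
rewrite plus_INR mult_INR => r1 r2 r3.
have k0 := pos_INR k.
have r4 : INR k * u n0 <= INR k * ((L + e) * INR n0) by nra.
have r5 : c - L' * INR m < INR k * e.
  have : 0 < e by rewrite /e; lra.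
  move=> he; have := Rmult_lt_compat_r e _ _ he hk.
  by have -> : (c - L' * INR m) / e * e = c - L' * INR m by field; lra.
have e0 : 0 <= e by rewrite /e; lra.
have ke : 0 <= INR k * e by nra.
have r6 : INR k * e <= INR k * INR n0 * e by nra.
have r7 : L' * (INR k * INR n0) = L * (INR k * INR n0) + 2 * (INR k * INR n0 * e) by rewrite /e; field.
lra.
Qed.

Lemma pow_unbounded (a b : R) : 1 < a -> exists N, forall n, (N <= n)%N -> b <= a ^ n.
Proof.
move=> ha; have [|N hN] := Pow_x_infinity a _ b; first by rewrite Rabs_right; lra.
exists N => n hn; have := hN n ltac:(lia); rewrite Rabs_right; first lra.
by left; apply: pow_lt; lra.
Qed.

Lemma periodic_abs_max (f : R -> R) : continuity f -> Periodic1 f ->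
  exists x0, forall x, Rabs (f x) <= Rabs (f x0).
Proof.
move=> hc hp.
have [||x0 [h0 _]] := continuity_ab_maj (fun x => Rabs (f x)) 0 1; first lra.
  move=> c _; apply: (continuity_pt_comp f Rabs); first exact: hc.
  exact: Rcontinuity_abs.
exists x0 => x; have hp' := Periodic1_Z hp.
have := hp' x (- Int_part x)%Z; rewrite opp_IZR => <-.
by apply: h0; have := base_Int_part x; lra.
Qed.

Lemma DerivSeq_der1 r f d : (1 <= r)%N -> DerivSeq r f d ->
  forall x, derivable_pt_lim f x (d 1%N x).
Proof.
move=> hr [h0 [h1 _]] x; apply: (derivable_pt_lim_ext _ _ _ _ h0).
by apply: h1; apply/leP.
Qed.

Lemma derivable_lim_continuity (f f' : R -> R) :
  (forall x, derivable_pt_lim f x (f' x)) -> continuity f.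
Proof. by move=> h x; apply: derivable_continuous_pt; exists (f' x); apply: h. Qed.

Lemma DerivSeq_continuity r f d k : (k <= r)%N -> DerivSeq r f d -> continuity (d k).
Proof.
move=> hk [_ [h1 h2]]; case: (ltngtP k r) => [{}hk||-> //]; last lia.
by apply: (@derivable_lim_continuity _ (d k.+1)) => x; apply: h1; apply/leP.
Qed.

Lemma derivative_periodic (f f' : R -> R) : Periodic1 f ->
  (forall x, derivable_pt_lim f x (f' x)) -> Periodic1 f'.
Proof.
move=> hp hd x; apply: (uniqueness_limite f (x + 1)); first exact: hd.
move=> eps he; have [d h] := hd x eps he; exists d => u u0 hu.
have := h u u0 hu; have -> : x + 1 + u = x + u + 1 by ring.
by rewrite !hp.
Qed.

Lemma DerivSeq_periodic r f d k : Periodic1 f -> DerivSeq r f d -> (k <= r)%N -> Periodic1 (d k).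
Proof.
move=> hp [h0 [h1 _]]; elim: k => [|k IH] hk; first by move=> x; rewrite !h0 hp.
by apply: (@derivative_periodic (d k)) => [|x]; [apply: IH; lia | apply: h1; lia].
Qed.

Section Rates.

Variable B : expanding_lift.
Local Notation E := (Emap B).
Local Notation E1 := (Eder B).
Local Notation G := (Einv B).
Local Notation l := (degree B).
Local Notation Q := (maxexp B).
Local Notation lam := (minexp B).
Local Notation dG := (dG B).
Local Notation slopeG := (slopeG B).
Let lam_gt1 : 1 < lam := minexp_gt1 B.

Definition maxhits psi th n : nat :=
  proj1_sig (constructive_indefinite_description _ (exists_max_hits B psi th n)).

Lemma maxhitsP psi th n : is_max_hits B psi th n (maxhits psi th n).
Proof. exact: proj2_sig (constructive_indefinite_description _ _). Qed.

Definition loghits psi th n : R := ln (INR (maxhits psi th n)).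

Lemma maxhits_gt0 psi th n : 0 <= th -> (0 < maxhits psi th n)%N.
Proof.
move=> th0; have [_ h] := maxhitsP psi th n.
exact: leq_trans (hits_pos B psi n 0 th0) (h _ _).
Qed.

Lemma loghits_ge0 psi th n : 0 <= th -> 0 <= loghits psi th n.
Proof.
move=> th0; rewrite /loghits -ln_1; have h := INR_leq (maxhits_gt0 psi n th0).
by case: h => [h|<-]; [left; apply: ln_increasing; rewrite /= in h; lra | right].
Qed.

Lemma ln_le (x y : R) : 0 < x -> x <= y -> ln x <= ln y.
Proof. by move=> h0 [h|->]; [left; apply: ln_increasing | right]. Qed.

Section Fixed.
Variables (psi : R -> R) (A : R).
Hypothesis psiZ : forall x (z : Z), psi (x + IZR z) = psi x.
Hypothesis psiA : forall x, Rabs (psi x) <= A.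

Lemma A_ge0 : 0 <= A.
Proof. by have := psiA 0; have := Rabs_pos (psi 0); lra. Qed.

Lemma loghits_add th th1 n m : 0 <= th -> 0 <= th1 ->
  (forall Y, Rabs (slopeG psi m Y) + th * dG m Y <= th1) ->
  loghits psi th (n + m) <= loghits psi th1 n + loghits psi th m.
Proof.
move=> h0 h1 hc; rewrite /loghits.
have p n' th' : 0 <= th' -> 0 < INR (maxhits psi th' n').
  by move=> h; apply: lt_0_INR; have := maxhits_gt0 psi n' h; lia.
rewrite -ln_mult; [|exact: p..].
apply: ln_le; first exact: p.
rewrite -mult_INR; apply: INR_leq.
have [[x [s <-]] _] := maxhitsP psi th (n + m).
have [_ ha] := maxhitsP psi th1 n; have [_ hb] := maxhitsP psi th m.
rewrite -mulnE; apply: leq_trans (@hits_add_le B psi th psiZ th1 n m _ x s hc hb) _.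
by rewrite leq_mul2r ha orbT.
Qed.

Lemma loghits0 th : 0 <= th -> loghits psi th 0 = 0.
Proof.
move=> h0; rewrite /loghits; suff -> : maxhits psi th 0 = 1%N by apply: ln_1.
apply/eqP; rewrite eqn_leq maxhits_gt0 // andbT.
by have [[x [s <-]] _] := maxhitsP psi th 0; apply: hits_le.
Qed.

Lemma loghits_sub R0 n m : A <= R0 ->
  loghits psi (R0 / (lam - 1)) (n + m) <= loghits psi (R0 / (lam - 1)) n + loghits psi (R0 / (lam - 1)) m.
Proof.
move=> h; have h0 : 0 <= R0 / (lam - 1).
  by apply: Rle_mult_inv_pos; have := A_ge0; lra.
apply: loghits_add => // Y; apply: slopeG_cone => x; have := psiA x; lra.
Qed.

Lemma rate_exists R0 : A <= R0 ->
  exists2 L, 0 <= L & is_rate (loghits psi (R0 / (lam - 1))) L.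
Proof.
move=> h; have h0 : 0 <= R0 / (lam - 1).
  by apply: Rle_mult_inv_pos; have := A_ge0; lra.
by apply: is_rate_exists => [n|]; [apply: loghits_ge0 | apply: loghits0].
Qed.

Lemma rate_le R1 R2 L1 L2 : A < R1 -> A < R2 ->
  is_rate (loghits psi (R1 / (lam - 1))) L1 ->
  is_rate (loghits psi (R2 / (lam - 1))) L2 -> L2 <= L1.
Proof.
have hA := A_ge0; move=> h1 h2 r1 r2.
have t1 : 0 <= R1 / (lam - 1) by apply: Rle_mult_inv_pos; lra.
have t2 : 0 <= R2 / (lam - 1) by apply: Rle_mult_inv_pos; lra.
have [m hm] := pow_unbounded (R2 / (R1 - A)) lam_gt1; have {}hm := hm m (leqnn m).
have pm : 0 < lam ^ m by apply: pow_lt; lra.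
have hm' : R2 * / lam ^ m <= R1 - A.
  apply: (Rmult_le_reg_r (lam ^ m)) => //; rewrite Rmult_assoc Rinv_l; last lra.
  have := Rmult_le_compat_l (R1 - A) _ _ ltac:(lra) hm.
  have -> : (R1 - A) * (R2 / (R1 - A)) = R2 by field; lra.
  lra.
apply: (is_rate_le (m := m) _ _ r1 r2 (c := loghits psi (R2 / (lam - 1)) m)).
- by move=> n k; apply: loghits_sub; lra.
- exact: loghits0.
move=> n; rewrite Rplus_comm; apply: loghits_add => // Y.
have s := slopeG_bound B m Y psiA; have d := dG_le B m Y.
have e : R2 / (lam - 1) * dG m Y <= (R1 - A) / (lam - 1).
  apply: Rle_trans (Rmult_le_compat_l _ _ _ t2 d) _.
  have -> : R2 / (lam - 1) * / lam ^ m = (R2 * / lam ^ m) / (lam - 1) by field; lra.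
  by apply: Rmult_le_compat_r => //; left; apply: Rinv_0_lt_compat; lra.
have -> : R1 / (lam - 1) = A / (lam - 1) + (R1 - A) / (lam - 1) by field; lra.
lra.
Qed.

End Fixed.

Lemma NLimit_rate tau psi R0 L : Periodic1 tau ->
  (forall x, derivable_pt_lim tau x (psi x)) -> continuity psi ->
  (forall x, Rabs (psi x) < R0) ->
  is_rate (loghits psi (R0 / (lam - 1))) L -> NLimit E E1 tau lam (exp L).
Proof.
move=> hp hd hc h0 hL Dtau hD Rc hRc.
have eD : Dtau = psi.
  by apply: functional_extensionality => x; apply: (uniqueness_limite tau x).
rewrite eD in hRc *; clear Dtau hD eD.
have pp := derivative_periodic hp hd; have pZ := Periodic1_Z pp.
have [x0 hA] := periodic_abs_max hc pp; set A := Rabs (psi x0) in hA.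
have a1 : A < R0 := h0 x0; have a2 : A < Rc := hRc x0.
have [L' hL0 hL'] := rate_exists hA (Rlt_le _ _ a2).
have eL : L' = L.
  by apply: Rle_antisym; [apply: (rate_le pZ hA a1 a2 hL) | apply: (rate_le pZ hA a2 a1 hL')].
have t2 : 0 <= Rc / (lam - 1).
  by apply: Rle_mult_inv_pos; have := A_ge0 hA; lra.
exists (fun n => maxhits psi (Rc / (lam - 1)) n.+1); split.
  move=> n; apply: IsNcount_max_hits => //; first exact: Periodic1_Z.
  exact: maxhitsP.
rewrite -eL; apply: (continuity_seq exp (fun n => / INR n.+1 * loghits psi (Rc / (lam - 1)) n.+1)).
  by apply: derivable_continuous_pt; exists (exp L'); apply: derivable_pt_lim_exp.
apply: is_rate_cv hL'; [|exact: loghits0|] => n; first exact: loghits_ge0.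
by move=> m; apply: (loghits_sub pZ hA); lra.
Qed.

Lemma NLimit_unique tau psi Rc L1 L2 : (forall x, derivable_pt_lim tau x (psi x)) ->
  (forall x, Rabs (psi x) < Rc) ->
  NLimit E E1 tau lam L1 -> NLimit E E1 tau lam L2 -> L1 = L2.
Proof.
move=> hd hR h1 h2.
have [a1 [n1 c1]] := h1 psi hd Rc hR; have [a2 [n2 c2]] := h2 psi hd Rc hR.
apply: (UL_sequence _ _ _ c1).
suff -> : a1 = a2 by [].
apply: functional_extensionality => n.
have [[z1 [v1 [K1 [g1 <-]]]] m1] := n1 n; have [[z2 [v2 [K2 [g2 <-]]]] m2] := n2 n.
have e1 := m1 _ _ _ g2; have e2 := m2 _ _ _ g1; lia.
Qed.

Definition small_growth (r : nat) (rho : R) (tau : R -> R) : Prop :=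
  CrS1 r tau /\ exists psi A R0 n m,
    (forall x, derivable_pt_lim tau x (psi x)) /\
    (forall x, Rabs (psi x) <= A) /\ A < R0 /\ (0 < n)%N /\
    (forall x s, (hits B psi (R0 / (lam - 1)) n x s <= m)%N) /\ INR m < rho ^ n.

Lemma small_growth_NLimit r rho tau : (1 <= r)%N -> 1 < rho -> small_growth r rho tau ->
  exists Lim, NLimit E E1 tau lam Lim /\ 1 <= Lim < rho.
Proof.
move=> hr hrho [[[d hd] hp] [psi [A [R0 [n [m [h1 [h2 [h3 [h4 [h5 h6]]]]]]]]]]].
have pZ := Periodic1_Z (derivative_periodic hp h1).
have cpsi : continuity psi.
  have := DerivSeq_continuity hr hd; suff -> : d 1%N = psi by [].
  apply: functional_extensionality => x.
  exact: (uniqueness_limite tau x _ _ (DerivSeq_der1 hr hd x) (h1 x)).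
have [L L0 hL] := rate_exists h2 (Rlt_le _ _ h3).
exists (exp L); split.
  by apply: (NLimit_rate (R0 := R0) hp h1) => // x; have := h2 x; lra.
split; first exact: exp_ge1.
have t2 : 0 <= R0 / (lam - 1).
  by apply: Rle_mult_inv_pos; have := A_ge0 h2; lra.
have [hL1 _] := hL; have := hL1 n.
have hmax : (maxhits psi (R0 / (lam - 1)) n <= m)%N.
  by have [[x [s <-]] _] := maxhitsP psi (R0 / (lam - 1)) n.
have g0 := maxhits_gt0 psi n t2.
have : loghits psi (R0 / (lam - 1)) n < ln rho * INR n.
  rewrite /loghits Rmult_comm -ln_pow; last lra.
  apply: ln_increasing; first by apply: lt_0_INR; lia.
  have := INR_leq hmax; lra.
have n0 : 0 < INR n by apply: lt_0_INR; lia.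
move=> a1 a2; have : L < ln rho by nra.
by move/exp_increasing; rewrite exp_ln; lra.
Qed.

Lemma small_growth_open r rho : (1 <= r)%N -> OpenCr r (small_growth r rho).
Proof.
move=> hr; split; first by move=> tau [].
move=> tau [_ [psi [A [R0 [n [m [h1 [h2 [h3 [h4 [h5 h6]]]]]]]]]]].
set D := / INR Q ^ n.
have hD : 0 < D by apply: Rinv_0_lt_compat; apply: pow_lt; have := Q_gt1 B; lra.
have D1 : D <= 1 by apply: Rle_trans (dG_ge B n 0) (dG_le1 B n 0).
set gap := (R0 - A) / 2.
exists (gap * D / 2); split; first by rewrite /gap; nra.
move=> sg hsg [ds [dt [hds [hdt hcl]]]]; split=> //.
have edt : dt 1%N = psi.
  apply: functional_extensionality => x.
  exact: (uniqueness_limite tau x _ _ (DerivSeq_der1 hr hdt x) (h1 x)).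
set e := gap * D / 2 in hcl.
have hdiff x : Rabs (ds 1%N x - psi x) <= e.
  by have := hcl 1%N x ltac:(lia); rewrite edt; lra.
have g0 : 0 < gap by rewrite /gap; lra.
have gD : 0 < gap * D by apply: Rmult_lt_0_compat.
have eR : e <= gap / 2 by rewrite /e; nra.
have eD : e <= gap * D by rewrite /e; lra.
exists (ds 1%N), (A + gap / 2), (A + gap), n, m.
split; first exact: (DerivSeq_der1 hr hds).
split.
  move=> x; have -> : ds 1%N x = psi x + (ds 1%N x - psi x) by ring.
  by apply: Rle_trans (Rabs_triang _ _) _; have := h2 x; have := hdiff x; lra.
split; first by rewrite /gap; lra.
split=> //; split=> // x s; apply: leq_trans (h5 x s).
have {2}-> : x = x + 0 by ring.
apply: hits_mono => // b /RlebP hb; apply/RlebP; rewrite Rplus_0_r.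
set X := x + INR b in hb *.
have eS : slopeG (ds 1%N) n X = slopeG psi n X + 1 * slopeG (fun x => ds 1%N x - psi x) n X.
  by rewrite -slopeG_lin; apply: slopeG_ext => y; ring.
have hs := slopeG_bound B n X hdiff.
have -> : s - slopeG psi n X = (s - slopeG (ds 1%N) n X) + slopeG (fun x => ds 1%N x - psi x) n X.
  by rewrite eS; ring.
apply: Rle_trans (Rabs_triang _ _) _.
have -> : R0 / (lam - 1) * dG n X = (A + gap) / (lam - 1) * dG n X + gap * dG n X / (lam - 1).
  by rewrite /gap; field; lra.
have : e / (lam - 1) <= gap * dG n X / (lam - 1).
  apply: Rmult_le_compat_r; first by left; apply: Rinv_0_lt_compat; lra.
  apply: Rle_trans eD _; apply: Rmult_le_compat_l; first by rewrite /gap; lra.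
  exact: dG_ge.
lra.
Qed.

End Rates.

(** * A localized derivative with small mean *)

Inductive trig : Type :=
  | TSin | TCos | TConst of R | TAdd of trig & trig | TMul of trig & trig.

Fixpoint teval (t : trig) (x : R) : R :=
  match t with
  | TSin => sin (PI * x)
  | TCos => cos (PI * x)
  | TConst c => c
  | TAdd t1 t2 => teval t1 x + teval t2 x
  | TMul t1 t2 => teval t1 x * teval t2 x
  end.

Fixpoint tderiv (t : trig) : trig :=
  match t with
  | TSin => TMul (TConst PI) TCos
  | TCos => TMul (TConst (- PI)) TSin
  | TConst _ => TConst 0
  | TAdd t1 t2 => TAdd (tderiv t1) (tderiv t2)
  | TMul t1 t2 => TAdd (TMul (tderiv t1) t2) (TMul t1 (tderiv t2))
  end.

Lemma derivable_pt_lim_eq (f : R -> R) x a b : a = b -> derivable_pt_lim f x a -> derivable_pt_lim f x b.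
Proof. by move=> ->. Qed.

Lemma tderiv_correct t x : derivable_pt_lim (teval t) x (teval (tderiv t) x).
Proof.
have hlin y : derivable_pt_lim (fun z => PI * z) y PI.
  apply: (@derivable_pt_lim_eq _ _ (PI * 1)); first ring.
  exact: (derivable_pt_lim_scal id PI y 1 (derivable_pt_lim_id y)).
elim: t x => [||c|t1 IH1 t2 IH2|t1 IH1 t2 IH2] x.
- apply: (@derivable_pt_lim_eq _ _ (cos (PI * x) * PI)); first by rewrite /=; ring.
  exact: (derivable_pt_lim_comp (fun z => PI * z) sin x _ _ (hlin x) (derivable_pt_lim_sin _)).
- apply: (@derivable_pt_lim_eq _ _ (- sin (PI * x) * PI)); first by rewrite /=; ring.
  exact: (derivable_pt_lim_comp (fun z => PI * z) cos x _ _ (hlin x) (derivable_pt_lim_cos _)).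
- exact: derivable_pt_lim_const.
- exact: derivable_pt_lim_plus.
- exact: derivable_pt_lim_mult.
Qed.

Fixpoint tcospow (k : nat) : trig := if k is k'.+1 then TMul TCos (tcospow k') else TConst 1.

Lemma tcospowE k x : teval (tcospow k) x = cos (PI * x) ^ k.
Proof. by elim: k => [|k IH] //=; rewrite IH. Qed.

Lemma tderiv_cospow k x :
  teval (tderiv (tcospow k.+1)) x = - PI * INR k.+1 * cos (PI * x) ^ k * sin (PI * x).
Proof.
elim: k => [|k IH]; first by rewrite /=; ring.
have e : teval (tderiv (tcospow k.+2)) x = - PI * sin (PI * x) * teval (tcospow k.+1) x
    + cos (PI * x) * teval (tderiv (tcospow k.+1)) x by [].
by rewrite e IH tcospowE (S_INR k.+1) -!tech_pow_Rmult; ring.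
Qed.

(** Wallis' reduction formula: [cosmean N] is the mean of [cos (PI x) ^ (2 N)]
    and [cosprim N] a primitive of [cos (PI x) ^ (2 N) - cosmean N]. *)
Fixpoint cosmean (N : nat) : R :=
  if N is N'.+1 then (2 * INR N' + 1) / (2 * INR N' + 2) * cosmean N' else 1.

Fixpoint cosprim (N : nat) : trig :=
  if N is N'.+1 then
    TAdd (TMul (TConst (/ ((2 * INR N' + 2) * PI))) (TMul (tcospow N'.*2.+1) TSin))
         (TMul (TConst ((2 * INR N' + 1) / (2 * INR N' + 2))) (cosprim N'))
  else TConst 0.

Lemma INR_double N : INR N.*2 = 2 * INR N.
Proof. by rewrite -muln2 mult_INR /=; ring. Qed.

Lemma cosprim_deriv N x :
  teval (tderiv (cosprim N)) x = cos (PI * x) ^ N.*2 - cosmean N.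
Proof.
elim: N => [|N IH]; first by rewrite /=; ring.
rewrite doubleS.
have e : teval (tderiv (cosprim N.+1)) x =
  / ((2 * INR N + 2) * PI) * (teval (tderiv (tcospow N.*2.+1)) x * sin (PI * x)
     + teval (tcospow N.*2.+1) x * (PI * cos (PI * x)))
  + (2 * INR N + 1) / (2 * INR N + 2) * teval (tderiv (cosprim N)) x.
  by rewrite /=; ring.
rewrite e IH tderiv_cospow tcospowE S_INR INR_double /=.
have h := sin2_cos2 (PI * x); rewrite /Rsqr in h.
have hp := PI_RGT_0; have hN := pos_INR N.
set s := sin _ in h *; set c := cos _ in h *; set C := c ^ N.*2.
have hs : s * s = 1 - c * c by lra.
have -> : - PI * (2 * INR N + 1) * C * s * s = - PI * (2 * INR N + 1) * C * (1 - c * c).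
  by rewrite -hs; ring.
field; lra.
Qed.

Lemma cosprim_per N x : teval (cosprim N) (x + 1) = teval (cosprim N) x.
Proof.
elim: N => [|N IH] //=.
rewrite IH !tcospowE; have -> : PI * (x + 1) = PI * x + PI by ring.
rewrite neg_sin neg_cos.
have -> : (- cos (PI * x)) ^ N.*2 = cos (PI * x) ^ N.*2.
  rewrite -mul2n !pow_mult; congr (_ ^ _); ring.
ring.
Qed.

Lemma cosmean_bounds N : 0 < cosmean N /\ cosmean N * cosmean N * (2 * INR N + 1) <= 1.
Proof.
elim: N => [|N [h1 h2]]; first by rewrite /=; lra.
have hN := pos_INR N; rewrite S_INR /=.
have h0 : 0 < (2 * INR N + 1) / (2 * INR N + 2) by apply: Rdiv_lt_0_compat; lra.
split; first exact: Rmult_lt_0_compat.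
set m := cosmean N in h1 h2 *; set n := INR N in hN h0 h2 *.
have -> : (2 * n + 1) / (2 * n + 2) * m * ((2 * n + 1) / (2 * n + 2) * m) * (2 * (n + 1) + 1)
  = (m * m * (2 * n + 1)) * ((2 * n + 1) * (2 * n + 3) / ((2 * n + 2) * (2 * n + 2))) by field; lra.
have : (2 * n + 1) * (2 * n + 3) / ((2 * n + 2) * (2 * n + 2)) <= 1.
  apply: (Rmult_le_reg_r ((2 * n + 2) * (2 * n + 2))); first nra.
  have -> : (2 * n + 1) * (2 * n + 3) / ((2 * n + 2) * (2 * n + 2)) * ((2 * n + 2) * (2 * n + 2)) = (2 * n + 1) * (2 * n + 3) by field; lra.
  nra.
have : 0 <= (2 * n + 1) * (2 * n + 3) / ((2 * n + 2) * (2 * n + 2)).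
  by apply: Rle_mult_inv_pos; nra.
have : 0 <= m * m * (2 * n + 1) by nra.
nra.
Qed.

Lemma cosmean_small kappa : 0 < kappa -> exists N0, forall N, (N0 <= N)%N -> cosmean N <= kappa.
Proof.
move=> hk; have [N0 h0] := INR_unbounded (/ (kappa * kappa)).
exists N0 => N /INR_leq hN; have [h1 h2] := cosmean_bounds N.
apply: Rnot_lt_le => hlt.
have : 1 < kappa * kappa * (2 * INR N + 1).
  have hkk : 0 < kappa * kappa by nra.
  have := Rmult_lt_compat_l _ _ _ hkk h0; rewrite Rinv_r; last lra.
  have := pos_INR N; nra.
have := pos_INR N; nra.
Qed.

Lemma cos_pow_small delta kappa : 0 < delta <= 1 / 2 -> 0 < kappa ->
  exists N0, forall N x, (N0 <= N)%N -> (forall z, delta <= Rabs (x - IZR z)) ->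
    cos (PI * x) ^ N.*2 <= kappa.
Proof.
move=> hd hk; have hp := PI_RGT_0.
set r := cos (PI * delta).
have r0 : 0 <= r by apply: cos_ge_0; nra.
have r1 : r < 1 by rewrite -cos_0; apply: cos_decreasing_1; nra.
have [N0 h0] := pow_lt_1_zero (r * r) ltac:(rewrite Rabs_right; nra) kappa hk.
exists N0 => N x hN hx.
have hi := base_Int_part x; set z := Int_part x in hi.
have y1 := hx z; have y2 := hx (z + 1)%Z.
rewrite plus_IZR in y2; rewrite Rabs_right in y1; last lra.
rewrite Rabs_left1 in y2; last lra.
have hcos : cos (PI * x) * cos (PI * x) = cos (PI * (x - IZR z)) * cos (PI * (x - IZR z)).
  have shift : forall t, cos (PI * (t + 1)) * cos (PI * (t + 1)) = cos (PI * t) * cos (PI * t).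
    by move=> t; have -> : PI * (t + 1) = PI * t + PI by [ring]; rewrite neg_cos; ring.
  have := Periodic1_Z (psi := fun t => cos (PI * t) * cos (PI * t)) shift x (- z)%Z.
  by rewrite opp_IZR => ->.
have c1 : cos (PI * (x - IZR z)) <= r by apply: cos_decr_1; nra.
have c2 : - r <= cos (PI * (x - IZR z)).
  have -> : - r = cos (PI * (1 - delta)).
    have -> : PI * (1 - delta) = - (PI * delta) + PI by ring.
    by rewrite neg_cos cos_neg.
  by apply: cos_decr_1; nra.
rewrite -mul2n pow_mult.
have -> : cos (PI * x) ^ 2 = cos (PI * x) * cos (PI * x) by ring.
rewrite hcos; set c := cos _ in c1 c2 *.
apply: Rle_trans (pow_incr (c * c) (r * r) N _) _; first by split; nra.
have := h0 N ltac:(lia); rewrite Rabs_right; first lra.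
by apply: Rle_ge; apply: pow_le; nra.
Qed.

Lemma kernel_exists (delta kappa : R) : 0 < delta <= 1 / 2 -> 0 < kappa <= 1 / 4 ->
  exists d : nat -> R -> R,
    (forall k x, derivable_pt_lim (d k) x (d k.+1 x)) /\
    Periodic1 (d 0%N) /\
    (forall x, - kappa <= d 1%N x <= 1) /\
    (forall x, (forall z, delta <= Rabs (x - IZR z)) -> d 1%N x <= kappa) /\
    exists2 eta, 0 < eta & forall x, Rabs x <= eta -> 1 / 2 <= d 1%N x.
Proof.
move=> hd hk.
have [N1 h1] := cosmean_small (proj1 hk).
have [N2 h2] := cos_pow_small hd (proj1 hk).
pose N := (N1 + N2)%N; have {}h1 := h1 N (leq_addr _ _); have {}h2 := h2 N ^~ (leq_addl _ _).
have [m0 _] := cosmean_bounds N.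
pose d k := teval (iter k tderiv (cosprim N)).
have d1 x : d 1%N x = cos (PI * x) ^ N.*2 - cosmean N by rewrite /d /= cosprim_deriv.
have hder k x : derivable_pt_lim (d k) x (d k.+1 x) by apply: tderiv_correct.
exists d; split=> //; split; first by move=> x; apply: cosprim_per.
have hc x : 0 <= cos (PI * x) ^ N.*2 <= 1.
  rewrite -mul2n pow_mult; have := COS_bound (PI * x); set c := cos _ => hc.
  split; first by apply: pow_le; nra.
  by rewrite -(pow1 N); apply: pow_incr; nra.
split; first by move=> x; rewrite d1; have := hc x; lra.
split; first by move=> x /h2; rewrite d1; lra.
have d10 : d 1%N 0 >= 3 / 4 by rewrite d1 Rmult_0_r cos_0 pow1; lra.
have hcont : continuity_pt (d 1%N) 0 by apply: (derivable_lim_continuity (hder 1%N)).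
have [a [a0 ha]] := hcont (1 / 4) ltac:(lra).
exists (a / 2); first lra.
move=> x hx; case: (Req_dec x 0) => [->|x0]; first lra.
have := ha x; rewrite /D_x /no_cond /dist /= /R_dist Rminus_0_r => /(_ _).
have hx' : Rabs x < a by lra.
move=> hh; have := hh (conj (conj I (fun e => x0 (esym e))) hx').
by move=> /Rlt_le /Rabs_le_between; lra.
Qed.

Lemma independent_set (T : finType) (e : rel T) (q p : nat) (A : {set T}) :
  (forall a, a \in A -> (#|[set b in A | e a b]| <= q)%N) ->
  (q.*2.+1 * p <= #|A|)%N ->
  exists s : seq T, [/\ size s = p, uniq s, {subset s <= A} &
    forall a b, a \in s -> b \in s -> a != b -> ~~ e a b].
Proof.
elim: p A => [|p IH] A hq hA; first by exists [::].
have A0 : (0 < #|A|)%N by apply: leq_trans hA; rewrite mulnS addSn.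
have [b hb hin] : exists2 b, b \in A & (#|[set a in A | e a b]| <= q)%N.
  apply/exists_inP; rewrite -[X in is_true X]negbK; apply/negP; rewrite negb_exists_in => /forall_inP hn.
  have : (\sum_(b in A) #|[set a in A | e a b]| <= \sum_(a in A) q)%N.
    have -> : (\sum_(b in A) #|[set a in A | e a b]| = \sum_(a in A) #|[set b in A | e a b]|)%N.
      have E1 (P : T -> T -> bool) x : #|[set y in A | P x y]| = (\sum_(y in A) P x y)%N.
        rewrite -sum1_card (eq_bigl (fun y => (y \in A) && P x y)); last by move=> y; rewrite inE.
        by rewrite big_mkcondr /=; apply: eq_bigr => y _; case: P.
      rewrite (eq_bigr _ (fun b _ => E1 (fun x y => e y x) b)).
      by rewrite [RHS](eq_bigr _ (fun b _ => E1 e b)) exchange_big.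
    by apply: leq_sum => a; apply: hq.
  have : (\sum_(b in A) q.+1 <= \sum_(b in A) #|[set a in A | e a b]|)%N.
    by apply: leq_sum => b hb; rewrite ltnNge hn.
  rewrite !sum_nat_const; nia.
pose A' := A :\: (b |: ([set a in A | e a b] :|: [set a in A | e b a])).
have sA : A' \subset A by apply: subsetDl.
have cA' : (q.*2.+1 * p <= #|A'|)%N.
  rewrite cardsD; set U := A :&: _.
  have : (#|U| <= 1 + (q + q))%N.
    apply: leq_trans (subset_leq_card (subsetIr _ _)) _.
    apply: leq_trans (leq_card_setU _ _) _; rewrite cards1 leq_add2l.
    by apply: leq_trans (leq_card_setU _ _) _; apply: leq_add => //; apply: hq.
  by move: hA; rewrite mulnS; lia.
have [|s [s1 s2 s3 s4]] := IH A' _ cA'.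
  move=> a ha; apply: leq_trans (hq a (subsetP sA a ha)); apply: subset_leq_card.
  by apply/subsetP => c; rewrite !inE => /andP[/andP[_ ->] ->].
have hbs a : a \in s -> [/\ a != b, ~~ e a b & ~~ e b a].
  move=> /s3; rewrite !inE !negb_or => /andP[/andP[-> /andP[]]] + + haA.
  by rewrite haA.
exists (b :: s); split=> /=; first by rewrite s1.
- by rewrite s2 andbT; apply/negP => /hbs[]; rewrite eqxx.
- by move=> a; rewrite inE => /orP[/eqP ->|/s3 /(subsetP sA)].
- move=> a c; rewrite !inE => /orP[/eqP ->|ha] /orP[/eqP ->|hc]; rewrite ?eqxx //.
  + by case: (hbs c hc).
  + by case: (hbs a ha).
  exact: s4.
Qed.

(** * Counting configurations *)

Definition natfloor (x : R) : nat := Z.to_nat (Int_part x).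

Lemma natfloorP x : 0 <= x -> INR (natfloor x) <= x < INR (natfloor x) + 1.
Proof.
move=> hx; have [h1 h2] := base_Int_part x.
have h0 : (0 <= Int_part x)%Z.
  by have : (-1 < Int_part x)%Z; [apply: lt_IZR; lra | lia].
by rewrite /natfloor INR_IZR_INZ Z2Nat.id //; lra.
Qed.

Lemma natfloor_lt x (n : nat) : 0 <= x -> x < INR n -> (natfloor x < n)%N.
Proof.
move=> h0 h; have [h1 h2] := natfloorP h0.
by apply/ltP; apply: INR_lt; lra.
Qed.

Lemma count_box (D K p : nat) (c : 'I_p -> 'I_D) (S : 'I_p -> {ffun 'I_D -> 'I_K} -> R)
    (w : 'I_p -> nat) (r lo : 'I_p -> R) (A : {set {ffun 'I_D -> 'I_K}}) :
  injective c -> (forall i, 0 < r i) ->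
  (forall t t' : {ffun 'I_D -> 'I_K}, t != t' -> (forall x, x \notin codom c -> t x = t' x) ->
     exists i, r i <= Rabs (S i t - S i t')) ->
  (forall t i, t \in A -> 0 <= S i t - lo i < r i * INR (w i)) ->
  (#|A| * K ^ p <= K ^ D * \prod_i w i)%N.
Proof.
move=> cinj r0 hsep hA.
pose cell i t := natfloor ((S i t - lo i) / r i).
have hcell i t : t \in A -> (cell i t < w i)%N.
  move=> /(hA t i) [h1 h2]; apply: natfloor_lt; first exact: Rle_mult_inv_pos.
  apply: (Rmult_lt_reg_r (r i)) => //.
  have -> : (S i t - lo i) / r i * r i = S i t - lo i by field; have := r0 i; lra.
  lra.
pose M := (K + \sum_i w i)%N.
pose code (t : {ffun 'I_D -> 'I_K}) : {ffun 'I_D -> 'I_M.+1} :=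
  [ffun x => inord (if [pick i | c i == x] is Some i then cell i t else t x)].
pose F (x : 'I_D) : {pred 'I_M.+1} := fun y : 'I_M.+1 =>
  (y < if [pick i | c i == x] is Some i then w i else K)%N.
have wM i : (w i <= M)%N by rewrite /M (bigD1 i) //=; lia.
have pickc i : [pick j | c j == c i] = Some i.
  by case: pickP => [j /eqP /cinj -> //|/(_ i)]; rewrite eqxx.
have hval t x : t \in A -> (code t x : nat) = (if [pick i | c i == x] is Some i then cell i t else t x).
  move=> tA; rewrite ffunE inordK //; case: pickP => [i _|_]; rewrite ltnS.
    by apply: leq_trans (wM i); apply: ltnW; apply: hcell.
  by apply: leq_trans (ltnW (ltn_ord (t x))) _; rewrite /M leq_addr.
have code_inj : {in A &, injective code}.
  move=> t t' tA t'A e; apply/eqP; apply: contraT => ne.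
  have [|i hi] := hsep t t' ne.
    move=> x hx; apply: val_inj; have := hval t x tA; have := hval t' x t'A; rewrite e => -> .
    case: pickP => // i /eqP ci; case/negP: hx; rewrite -ci; exact: codom_f.
  have := hval t (c i) tA; have := hval t' (c i) t'A; rewrite e => ->; rewrite pickc => ee.
  have [a1 _] := hA t i tA; have [a2 _] := hA t' i t'A; have ri := r0 i.
  have b1 := natfloorP (Rle_mult_inv_pos _ _ a1 ri).
  have b2 := natfloorP (Rle_mult_inv_pos _ _ a2 ri).
  rewrite -/(cell i t) in b1; rewrite -/(cell i t') ee in b2.
  have : Rabs ((S i t - lo i) * / r i - (S i t' - lo i) * / r i) < 1 by apply: Rabs_def1; lra.
  have -> : (S i t - lo i) * / r i - (S i t' - lo i) * / r i = (S i t - S i t') / r i by field; lra.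
  rewrite Rabs_divp // => /(Rmult_lt_compat_r (r i) _ _ ri).
  have -> : Rabs (S i t - S i t') / r i * r i = Rabs (S i t - S i t') by field; lra.
  lra.
have hcard : (#|A| <= #|family F|)%N.
  rewrite -(card_in_imset code_inj); apply: subset_leq_card; apply/subsetP => _ /imsetP[t tA ->].
  apply/familyP => x; rewrite /F unfold_in /= hval //; case: pickP => // i _; exact: hcell.
have hF : (#|family F| = \prod_x #|F x|)%N.
  by rewrite card_family foldrE big_map enumT.
have hFx x : (#|F x| <= if [pick i | c i == x] is Some i then w i else K)%N.
  set N := (X in (_ <= X)%N).
  have -> : #|F x| = size (map val (enum (F x))) by rewrite size_map -cardE.
  rewrite -[X in (_ <= X)%N](size_iota 0); apply: uniq_leq_size.
    by rewrite (map_inj_uniq val_inj) enum_uniq.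
  by move=> _ /mapP[y hy ->]; rewrite mem_iota add0n; move: hy; rewrite mem_enum.
apply: leq_trans (_ : (\prod_x (if [pick i | c i == x] is Some i then w i else K)) * K ^ p <= _)%N.
  rewrite leq_mul2r (leq_trans hcard) ?orbT // hF; exact: leq_prod.
have -> : (K ^ p = \prod_(i < p) K)%N by rewrite prod_nat_const card_ord.
have -> : (K ^ D = \prod_(x < D) K)%N by rewrite prod_nat_const card_ord.
rewrite (partition_big c xpredT) //= [X in (_ <= _ * X)%N](partition_big c xpredT) //=.
rewrite -!big_split /=; apply: leq_prod => x _.
case: pickP => [i /eqP ci|h].
  have e j : (c j == x) = (j == i) by rewrite -ci; apply/eqP/eqP => [/cinj|->].
  by rewrite !(big_pred1 i) // mulnC.
by rewrite !big_pred0 // .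
Qed.

Lemma moment_bound (T : finType) (p N K D C H : nat)
    (h : T -> 'I_p -> 'I_N -> bool) (w : 'I_p -> 'I_N -> nat) :
  (0 < K)%N ->
  (forall b : {ffun 'I_p -> 'I_N},
     #|[set t | [forall i, h t i (b i)]]| * K ^ p <= K ^ D * \prod_i w i (b i))%N ->
  (forall i, \sum_b w i b <= K * C)%N ->
  (#|[set t | [forall i, H <= \sum_b h t i b]]| * H ^ p <= K ^ D * C ^ p)%N.
Proof.
move=> K0 hb hw; rewrite -(@leq_pmul2r (K ^ p)); last by rewrite expn_gt0 K0.
set A := finset _.
have e1 : (#|A| * H ^ p <= \sum_t \prod_(i < p) \sum_b h t i b)%N.
  rewrite -sum_nat_const big_mkcond /=; apply: leq_sum => t _; case: ifP => //.
  rewrite inE => /forallP ht.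
  have -> : (H ^ p = \prod_(i < p) H)%N by rewrite prod_nat_const card_ord.
  by apply: leq_prod => i _.
have e2 : (\sum_t \prod_(i < p) \sum_b h t i b =
   \sum_(b : {ffun 'I_p -> 'I_N}) #|[set t | [forall i, h t i (b i)]]|)%N.
  rewrite (eq_bigr _ (fun t _ => bigA_distr_bigA (fun i b => nat_of_bool (h t i b)))) exchange_big /=.
  apply: eq_bigr => b _; rewrite -sum1_card [RHS]big_mkcond /=; apply: eq_bigr => t _.
  rewrite inE; case: forallP => [ht|hn].
    by rewrite big1 // => i _; rewrite ht.
  have [i hi] : exists i, ~~ h t i (b i).
    by apply/existsP; rewrite -negb_forall; apply/forallP.
  by rewrite (bigD1 i) //= (negbTE hi) mul0n.
apply: leq_trans (_ : (\sum_(b : {ffun 'I_p -> 'I_N}) #|[set t | [forall i, h t i (b i)]]|) * K ^ p <= _)%N.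
  by rewrite leq_mul2r -e2 e1 orbT.
rewrite big_distrl /=.
apply: leq_trans (_ : \sum_(b : {ffun 'I_p -> 'I_N}) K ^ D * \prod_i w i (b i) <= _)%N.
  by apply: leq_sum => b _; apply: hb.
rewrite -big_distrr /= -(bigA_distr_bigA w) -mulnA leq_mul2l; apply/orP; right.
rewrite -expnMn mulnC.
have -> : ((K * C) ^ p = \prod_(i < p) (K * C))%N by rewrite prod_nat_const card_ord.
exact: leq_prod.
Qed.

Section Rich.
Variable B : expanding_lift.
Local Notation G := (Einv B).
Local Notation l := (degree B).
Variables (psi : R -> R) (th : R).
Hypothesis psiZ : forall x (z : Z), psi (x + IZR z) = psi x.
Variables (q P H J : nat).

(** [a < l ^ q] stands for the preimage [iter q G (x + a)] of [x], and [b] for the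
    preimages of the latter under [j * q] further iterates. *)
Definition rich_classes (j : nat) (x s : R) : {set 'I_(l ^ q)} :=
  [set a : 'I_(l ^ q) | (H <= \sum_(b < l ^ (j * q))
     hit B psi th (q + j * q) s (x + INR a + INR b * INR l ^ q))%N].

Lemma hits_not_rich : (0 < P)%N -> (0 < H)%N ->
  (forall j x s, (j < J)%N -> 0 <= x < 1 -> (#|rich_classes j x s| <= P)%N) ->
  forall j x s, (j <= J)%N -> (hits B psi th (j * q) x s <= (2 * P) ^ j * (l ^ q * H))%N.
Proof.
move=> P0 H0 hP; elim=> [|j IH] x s hj.
  rewrite mul0n expn0 mul1n; apply: leq_trans (hits_le _ _ _ _ _ _) _.
  by rewrite expn0 muln_gt0 degree_pow_gt0.
have hx := base_Int_part x.
rewrite -(@hits_shift B psi th psiZ (j.+1 * q) x s (- Int_part x)) opp_IZR.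
set y := x + - _; have hy : 0 <= y < 1 by rewrite /y; lra.
rewrite mulSn hits_split.
set M := ((2 * P) ^ j * (l ^ q * H))%N in IH.
have hM : (l ^ q * H <= M)%N by rewrite /M leq_pmull // expn_gt0 muln_gt0 P0.
apply: leq_trans (_ : \sum_(a < l ^ q) ((a \in rich_classes j y s) * M + H) <= _)%N.
  apply: leq_sum => a _; case: (boolP (a \in _)); last first.
    by rewrite inE -ltnNge mul0n add0n => /ltnW.
  move=> _; rewrite mul1n; apply: leq_trans (leq_addr _ _).
  apply: leq_trans (IH (iter q G (y + INR a)) ((s - slopeG B psi q (y + INR a)) / dG B q (y + INR a)) (ltnW hj)).
  by apply: leq_sum => b _; rewrite hit_add.
rewrite big_split /= -big_distrl /= sum_nat_const card_ord.
have -> : (\sum_(a < l ^ q) (a \in rich_classes j y s) = #|rich_classes j y s|)%N.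
  by rewrite -sum1_card [RHS]big_mkcond /=; apply: eq_bigr => a _; case: (a \in _).
have hc := hP j y s hj hy.
have -> : ((2 * P) ^ j.+1 * (l ^ q * H) = 2 * P * M)%N by rewrite expnS /M !mulnA.
apply: leq_trans (leq_add (leq_mul hc (leqnn M)) hM) _.
by rewrite -mulnA mul2n -addnn leq_add2l leq_pmull.
Qed.

End Rich.

(** * Localized perturbations of the slope *)

Definition decideb (P : Prop) : bool := if excluded_middle_informative P then true else false.

Lemma decidebP P : reflect P (decideb P).
Proof. by rewrite /decideb; case: excluded_middle_informative => h; constructor. Qed.

Section Geometry.
Variable B : expanding_lift.
Local Notation E := (Emap B).
Local Notation E1 := (Eder B).
Local Notation G := (Einv B).
Local Notation l := (degree B).
Local Notation Q := (maxexp B).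
Local Notation lam := (minexp B).
Local Notation dG := (dG B).
Local Notation slopeG := (slopeG B).
Let lam_gt1 : 1 < lam := minexp_gt1 B.

Lemma slopeG_ge0 f n X : (forall x, 0 <= f x) -> 0 <= slopeG f n X.
Proof.
move=> hf; elim: n X => [|n IH] X /=; first lra.
apply: Rle_mult_inv_pos; last by have := E1_gt1 B (G X); lra.
by have := hf (G X); have := IH (G X); lra.
Qed.

Lemma slopeG_ge_term f q n X : (0 < q <= n)%N -> (forall x, 0 <= f x) ->
  dG q X * f (iter q G X) <= slopeG f n X.
Proof.
case: q => // q hq hf.
have -> : n = (q + (1 + (n - q.+1)))%N by lia.
set r := (n - q.+1)%N.
rewrite !slopeG_add -(addn1 q) dG_add addn1 iterS /=.
set Y := iter q G X.
have h1 := slopeG_ge0 q X hf.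
have h2 := slopeG_ge0 r (G Y) hf.
have h3 := dG_gt0 B q X; have h4 := E1_gt1 B (G Y).
have e : (f (G Y) + 0) / E1 (G Y) + 1 / E1 (G Y) * slopeG f r (G Y) =
  1 / E1 (G Y) * f (G Y) + 1 / E1 (G Y) * slopeG f r (G Y) by field; lra.
rewrite e.
have h5 : 0 <= 1 / E1 (G Y) by apply: Rle_mult_inv_pos; lra.
have h6 : 0 <= 1 / E1 (G Y) * slopeG f r (G Y) by apply: Rmult_le_pos.
have h7 := Rmult_le_pos _ _ (Rlt_le _ _ h3) h6.
nra.
Qed.

Lemma slopeG_orbit_bound f A n X :
  (forall k, (0 < k <= n)%N -> Rabs (f (iter k G X)) <= A) -> 0 <= A ->
  Rabs (slopeG f n X) <= A / (lam - 1).
Proof.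
move=> + A0; elim: n X => [|n IH] X hf /=.
  by rewrite Rabs_R0; apply: Rle_mult_inv_pos; lra.
have hE := Eder_ge B (G X).
rewrite Rabs_divp; last lra.
have h1 : Rabs (slopeG f n (G X)) <= A / (lam - 1).
  by apply: IH => k hk; have := hf k.+1; rewrite iterSr; apply; lia.
have h2 := hf 1%N isT; rewrite /= in h2.
apply: (Rmult_le_reg_r (E1 (G X))); first lra.
have -> : forall u, u / E1 (G X) * E1 (G X) = u by move=> u; field; lra.
apply: Rle_trans (Rabs_triang _ _) _.
have e : A / (lam - 1) * (lam - 1) = A by field; lra.
have : 0 <= A / (lam - 1) by apply: Rle_mult_inv_pos; lra.
nra.
Qed.

Lemma slopeG_diag f kappa q n X : (0 < q <= n)%N -> 0 <= kappa ->
  (forall x, - kappa <= f x) -> 1 / 2 <= f (iter q G X) ->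
  kappa * INR Q ^ q / (lam - 1) <= 1 / 4 -> dG q X / 4 <= slopeG f n X.
Proof.
move=> hq k0 hf hX hk.
have e : slopeG f n X = slopeG (fun x => f x + kappa * 1) n X + - kappa * slopeG (fun=> 1) n X.
  by rewrite -slopeG_lin; apply: slopeG_ext => y; ring.
have h1 : dG q X * (f (iter q G X) + kappa * 1) <= slopeG (fun x => f x + kappa * 1) n X.
  by apply: (@slopeG_ge_term (fun x => f x + kappa * 1)) => // x; have := hf x; lra.
have h2 := @slopeG_bound B (fun=> 1) 1 n X (fun _ => Req_le _ _ (Rabs_R1)).
have h2' := Rle_abs (slopeG (fun=> 1) n X).
have h3 := dG_ge B q X; have h4 := dG_gt0 B q X.
have Qp : 0 < INR Q ^ q by apply: pow_lt; have := Q_gt1 B; lra.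
have h5 : kappa / (lam - 1) <= dG q X / 4.
  apply: Rle_trans (_ : / INR Q ^ q / 4 <= _); last lra.
  apply: (Rmult_le_reg_r (INR Q ^ q)) => //.
  have -> : / INR Q ^ q / 4 * INR Q ^ q = 1 / 4 by field; lra.
  by have -> : kappa / (lam - 1) * INR Q ^ q = kappa * INR Q ^ q / (lam - 1) by field; lra.
have h6 : kappa * slopeG (fun=> 1) n X <= kappa / (lam - 1).
  have -> : kappa / (lam - 1) = kappa * (1 / (lam - 1)) by field; lra.
  by apply: Rmult_le_compat_l; lra.
rewrite e; nra.
Qed.

Lemma slopeG_offdiag f kappa beta q n X : (q <= n)%N -> 0 <= kappa ->
  (forall x, Rabs (f x) <= 1) ->
  (forall k, (0 < k <= 2 * q)%N -> Rabs (f (iter k G X)) <= kappa) ->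
  kappa * INR Q ^ q / (lam - 1) <= beta / 2 ->
  / lam ^ q / (lam - 1) <= beta / 2 ->
  Rabs (slopeG f n X) <= beta * dG q X.
Proof.
move=> hq k0 hf hX hk hl.
have h3 := dG_ge B q X; have h4 := dG_gt0 B q X.
have Qp : 0 < INR Q ^ q by apply: pow_lt; have := Q_gt1 B; lra.
have h5 : kappa / (lam - 1) <= beta / 2 * dG q X.
  have b0 : 0 <= beta / 2.
    by apply: Rle_trans hk; apply: Rle_mult_inv_pos; nra.
  apply: Rle_trans (_ : beta / 2 * / INR Q ^ q <= _); last by apply: Rmult_le_compat_l.
  apply: (Rmult_le_reg_r (INR Q ^ q)) => //.
  have -> : beta / 2 * / INR Q ^ q * INR Q ^ q = beta / 2 by field; lra.
  by have -> : kappa / (lam - 1) * INR Q ^ q = kappa * INR Q ^ q / (lam - 1) by field; lra.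
have hsplit : Rabs (slopeG f n X) <= kappa / (lam - 1) + dG q X * (/ lam ^ q / (lam - 1)).
  have tail0 : 0 <= dG q X * (/ lam ^ q / (lam - 1)).
    apply: Rmult_le_pos; first lra.
    by apply: Rle_mult_inv_pos; [left; apply: Rinv_0_lt_compat; apply: pow_lt; lra | lra].
  case: (leqP n (2 * q)) => hn.
    suff : Rabs (slopeG f n X) <= kappa / (lam - 1) by lra.
    by apply: slopeG_orbit_bound => // k hk'; apply: hX; lia.
  have -> : n = (q + q + (n - 2 * q))%N by lia.
  rewrite slopeG_add; apply: Rle_trans (Rabs_triang _ _) _; apply: Rplus_le_compat.
    by apply: slopeG_orbit_bound => // k hk'; apply: hX; lia.
  rewrite dG_add Rmult_assoc Rabs_mult (Rabs_right (dG q X)); last lra.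
  apply: Rmult_le_compat_l; first lra.
  have d1 := dG_le B q (iter q G X); have d0 := dG_gt0 B q (iter q G X).
  rewrite Rabs_mult (Rabs_right (dG q _)); last lra.
  have := @slopeG_bound B f 1 (n - 2 * q) (iter (q + q) G X) hf.
  have -> : / lam ^ q / (lam - 1) = / lam ^ q * (1 / (lam - 1)) by field; split; [lra | apply: pow_nonzero; lra].
  by move=> h; apply: Rmult_le_compat => //; [lra | apply: Rabs_pos].
nra.
Qed.

Definition near (d : R) (k : nat) (u v : R) : Prop :=
  exists z : Z, Rabs (iter k E u - v - IZR z) < d.

Lemma near_unique d q k u x (a b : nat) : d <= / INR Q ^ q / 2 ->
  (a < l ^ q)%N -> (b < l ^ q)%N ->
  near d k u (iter q G (x + INR a)) -> near d k u (iter q G (x + INR b)) -> a = b.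
Proof.
move=> hd ha hb [z1 h1] [z2 h2].
set ua := iter q G _ in h1; set ub := iter q G _ in h2.
have Qp : 0 < INR Q ^ q by apply: pow_lt; have := Q_gt1 B; lra.
have h : Rabs (ua - (ub + IZR (z2 - z1))) < / INR Q ^ q.
  rewrite minus_IZR; have -> : ua - (ub + (IZR z2 - IZR z1)) =
    (iter k E u - ub - IZR z2) - (iter k E u - ua - IZR z1) by ring.
  by apply: Rle_lt_trans (Rabs_triang _ _) _; rewrite Rabs_Ropp; lra.
have := iterE_expand B q ua (ub + IZR (z2 - z1)).
rewrite iterE_addZ /ua /ub !iterE_iterG -/ua -/ub => hh.
have h' : Rabs (x + INR a - (x + INR b + IZR (z2 - z1) * INR l ^ q)) < 1.
  apply: Rle_lt_trans hh _; rewrite -(Rinv_r (INR Q ^ q)); last lra.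
  exact: Rmult_lt_compat_l.
apply: (@IZR_neq_between (z2 - z1) (l ^ q)) => //.
rewrite INR_expn.
set w := (z2 - z1)%Z in h' *; clearbody w.
have e : x + INR a - (x + INR b + IZR w * INR l ^ q) = IZR (Z.of_nat a - Z.of_nat b - w * Z.of_nat (l ^ q)).
  by rewrite !minus_IZR mult_IZR -!INR_IZR_INZ INR_expn; ring.
rewrite e in h'.
have h0 : (Z.of_nat a - Z.of_nat b - w * Z.of_nat (l ^ q))%Z = 0%Z.
  have [l1 l2] := Rabs_def2 _ _ h'.
  have l3 := lt_IZR _ 1 l1; have l4 := lt_IZR (-1) _ l2; lia.
rewrite h0 in e; lra.
Qed.

Definition linked (q : nat) (d x : R) : rel 'I_(l ^ q) := fun a b =>
  (a != b) && [exists k : 'I_q.+1, decideb (near d k (iter q G (x + INR a)) (iter q G (x + INR b)))].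

Lemma linked_outdeg q d x (A : {set 'I_(l ^ q)}) a : d <= / INR Q ^ q / 2 ->
  (#|[set b in A | linked d x a b]| <= q.+1)%N.
Proof.
move=> hd.
pose N (k : 'I_q.+1) : {set 'I_(l ^ q)} := [set b : 'I_(l ^ q) | decideb (near d k (iter q G (x + INR a)) (iter q G (x + INR b)))].
have N1 k : (#|N k| <= 1)%N.
  apply/card_le1_eqP => b c; rewrite !inE => /decidebP hb /decidebP hc.
  by apply: val_inj; rewrite /= (near_unique hd (ltn_ord b) (ltn_ord c) hb hc).
apply: leq_trans (_ : \sum_(b < l ^ q) \sum_(k < q.+1) (b \in N k) <= _)%N.
  rewrite -sum1_card big_mkcond /=; apply: leq_sum => b _; case: ifP => //.
  rewrite inE => /andP[_ /andP[_ /existsP[k hk]]].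
  by rewrite (bigD1 k) //= inE hk.
rewrite exchange_big /= -[X in (_ <= X)%N]card_ord -sum1_card; apply: leq_sum => k _.
apply: leq_trans (N1 k); rewrite -sum1_card [X in (_ <= X)%N]big_mkcond /=.
by apply: leq_sum => b _; case: (b \in _).
Qed.

Lemma orbit_far q d x (a b : nat) X (z : Z) c :
  (forall k, (k <= q)%N -> ~ near (2 * INR Q ^ q * d) k (iter q G (x + INR a)) (iter q G (x + INR b))) ->
  (forall k, (k <= q)%N -> ~ near (2 * INR Q ^ q * d) k (iter q G (x + INR b)) (iter q G (x + INR a))) ->
  0 < d -> (exists z, Rabs (iter q G (x + INR b) - c - IZR z) <= d) ->
  iter q G X = iter q G (x + INR a) + IZR z ->
  forall k (w : Z), (0 < k <= 2 * q)%N -> d <= Rabs (iter k G X - c - IZR w).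
Proof.
move=> h1 h2 d0 [zc hc] hX k w hk.
set ua := iter q G (x + INR a) in h1 h2 hX; set ub := iter q G (x + INR b) in h1 h2 hc.
apply: Rnot_lt_le => hlt.
have Q1 : 1 <= INR Q ^ q by apply: pow_R1_Rle; have := Q_gt1 B; lra.
have hd : Rabs (iter k G X - ub - IZR (w - zc)) < 2 * d.
  have -> : iter k G X - ub - IZR (w - zc) = (iter k G X - c - IZR w) - (ub - c - IZR zc) by rewrite minus_IZR; ring.
  by apply: Rle_lt_trans (Rabs_triang _ _) _; rewrite Rabs_Ropp; lra.
case: (leqP k q) => hkq.
  apply: (h1 (q - k)%N (leq_subr _ _)).
  have e : iter k G X = iter (q - k) E ua + IZR z * INR l ^ (q - k).
    rewrite -iterE_addZ -hX; have {2}-> : q = (q - k + k)%N by lia.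
    by rewrite iterD iterE_iterG.
  exists (w - zc - z * Z.of_nat (l ^ (q - k)))%Z.
  rewrite minus_IZR mult_IZR -INR_IZR_INZ INR_expn.
  have -> : iter (q - k) E ua - ub - (IZR (w - zc) - IZR z * INR l ^ (q - k)) = iter k G X - ub - IZR (w - zc).
    by rewrite e; ring.
  by apply: Rlt_le_trans hd _; nra.
apply: (h2 (k - q)%N); first lia.
have e : iter (k - q) E (iter k G X) = ua + IZR z.
  rewrite -hX; have {2}-> : k = (k - q + q)%N by lia.
  by rewrite iterD iterE_iterG.
have := iterE_expand B (k - q) (iter k G X) (ub + IZR (w - zc)).
rewrite e iterE_addZ => hh.
exists (z - (w - zc) * Z.of_nat (l ^ (k - q)))%Z.
rewrite minus_IZR mult_IZR -INR_IZR_INZ INR_expn Rabs_minus_sym.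
have hQ : INR Q ^ (k - q) <= INR Q ^ q by apply: Rle_pow; [have := Q_gt1 B; lra | lia].
have hQ0 : 0 < INR Q ^ (k - q) by apply: pow_lt; have := Q_gt1 B; lra.
apply: Rle_lt_trans (_ : Rabs (ua + IZR z - (iter (k - q) E ub + IZR (w - zc) * INR l ^ (k - q))) < _).
  by right; congr Rabs; ring.
apply: Rle_lt_trans hh _.
have -> : iter k G X - (ub + IZR (w - zc)) = iter k G X - ub - IZR (w - zc) by ring.
have := Rabs_pos (iter k G X - ub - IZR (w - zc)); nra.
Qed.

Lemma sum_dG_le m Y (N : nat) (F : nat -> nat) C : 0 <= C ->
  (forall b, INR (F b) <= C * dG m (Y + INR b)) ->
  INR (\sum_(b < N) F b) <= C * Cdist B * (iter m G (Y + INR N) - iter m G Y).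
Proof.
move=> C0 hF; elim: N => [|N IH].
  by rewrite big_ord0 /= Rplus_0_r; lra.
have -> : (\sum_(b < N.+1) F b)%N = (\sum_(b < N) F b + F N)%N by rewrite big_ord_recr.
rewrite plus_INR S_INR.
have := dG_unit_gap B m (Y + INR N); rewrite Rplus_assoc.
have := hF N; move=> h1 h2.
have := Rmult_le_compat_l _ _ _ C0 h2; lra.
Qed.

Lemma sum_dG_full m Y (F : nat -> nat) C : 0 <= C ->
  (forall b, INR (F b) <= C * dG m (Y + INR b)) ->
  INR (\sum_(b < l ^ m) F b) <= C * Cdist B.
Proof.
move=> C0 hF; have := sum_dG_le (l ^ m) C0 hF.
have := iterG_addZ B m Y 1; rewrite Rmult_1_l INR_expn => ->.
by have -> : C * Cdist B * (iter m G Y + 1 - iter m G Y) = C * Cdist B by ring.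
Qed.

End Geometry.

(** * A finite-dimensional family of perturbations *)

HB.instance Definition _ := Monoid.isComLaw.Build R 0 Rplus
  (fun x y z => esym (Rplus_assoc x y z)) Rplus_comm Rplus_0_l.

Local Notation "'rsum' ( i < n ) F" := (\big[Rplus/0]_(i < n) F)
  (at level 41, i, n at level 50, F at level 41).

(** [big_cons] and [bigD1] with [Rplus] itself, as [lra] expects it, instead of
    its canonical monoid structure. *)
Lemma rsum_cons (I : Type) (i : I) (s : seq I) (F : I -> R) :
  \big[Rplus/0]_(j <- i :: s) F j = F i + \big[Rplus/0]_(j <- s) F j.
Proof. exact: big_cons. Qed.

Lemma rsumD1 (I : finType) (i : I) (F : I -> R) :
  \big[Rplus/0]_j F j = F i + \big[Rplus/0]_(j | j != i) F j.
Proof. by rewrite (bigD1 i). Qed.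

Lemma rsum_bound (I : finType) (P : pred I) (g : I -> R) (m : I -> nat) M :
  (forall i, P i -> Rabs (g i) <= M * INR (m i)) ->
  Rabs (\big[Rplus/0]_(i | P i) g i) <= M * INR (\sum_(i | P i) m i).
Proof.
move=> h; elim/big_rec2: _ => [|i n x Pi IH]; first by rewrite Rabs_R0 Rmult_0_r; lra.
rewrite plus_INR; apply: Rle_trans (Rabs_triang _ _) _; have := h i Pi; lra.
Qed.

Lemma rsum_bound_const (D : nat) (g : 'I_D -> R) M :
  (forall i, Rabs (g i) <= M) -> Rabs (rsum (i < D) g i) <= M * INR D.
Proof.
move=> h; have := @rsum_bound 'I_D xpredT g (fun=> 1%N) M.
by rewrite sum1_card card_ord; apply=> i _; rewrite Rmult_1_r.
Qed.

Section Family.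
Variable B : expanding_lift.
Local Notation G := (Einv B).
Local Notation dG := (dG B).
Local Notation slopeG := (slopeG B).
Variables (D K : nat) (eps0 : R).
Hypothesis K_gt0 : (0 < K)%N.
Hypothesis eps0_gt0 : 0 < eps0.

Definition coef (t : {ffun 'I_D -> 'I_K}) (c : 'I_D) : R := eps0 * INR (t c) / INR K.

Definition center (c : 'I_D) : R := INR c / INR D.

Definition pert (f0 f : R -> R) (t : {ffun 'I_D -> 'I_K}) (x : R) : R :=
  f0 x + rsum (c < D) coef t c * f (x - center c).

Lemma coef_bound t c : 0 <= coef t c <= eps0.
Proof.
have hK : 0 < INR K by apply: lt_0_INR; lia.
have h1 : INR (t c) <= INR K by apply: INR_leq; apply: ltnW.
have h2 := pos_INR (t c).
split; first by apply: Rle_mult_inv_pos => //; nra.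
apply: (Rmult_le_reg_r (INR K)) => //.
have -> : coef t c * INR K = eps0 * INR (t c) by rewrite /coef; field; lra.
nra.
Qed.

Lemma slopeG_pert f0 f t n X :
  slopeG (pert f0 f t) n X =
  slopeG f0 n X + rsum (c < D) coef t c * slopeG (fun x => f (x - center c)) n X.
Proof.
rewrite /pert; elim: (index_enum _) => [|c s IH].
  rewrite big_nil Rplus_0_r; apply: slopeG_ext => x; by rewrite big_nil Rplus_0_r.
rewrite rsum_cons; transitivity (slopeG (fun x => (f0 x + \big[Rplus/0]_(c <- s) (coef t c * f (x - center c)))
    + coef t c * f (x - center c)) n X); last by rewrite slopeG_lin IH Rplus_assoc; congr (_ + _); apply: Rplus_comm.
by apply: slopeG_ext => x; rewrite rsum_cons Rplus_assoc; congr (_ + _); apply: Rplus_comm.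
Qed.

Lemma pert_bound f0 f t A0 M x : (forall x, Rabs (f0 x) <= A0) -> (forall x, Rabs (f x) <= M) ->
  Rabs (pert f0 f t x) <= A0 + eps0 * M * INR D.
Proof.
move=> h0 h; apply: Rle_trans (Rabs_triang _ _) _; apply: Rplus_le_compat => //.
apply: rsum_bound_const => c; have := coef_bound t c; rewrite Rabs_mult => hc.
by rewrite (Rabs_right (coef t c)); [apply: Rmult_le_compat; [lra|apply: Rabs_pos|lra|] | lra].
Qed.

Lemma pert_sub f0 f t x y : pert f0 f t x - pert f0 f t y =
  (f0 x - f0 y) + rsum (c < D) coef t c * (f (x - center c) - f (y - center c)).
Proof.
have aux (s : seq 'I_D) : f0 x + \big[Rplus/0]_(c <- s) (coef t c * f (x - center c)) -
    (f0 y + \big[Rplus/0]_(c <- s) (coef t c * f (y - center c))) =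
    f0 x - f0 y + \big[Rplus/0]_(c <- s) (coef t c * (f (x - center c) - f (y - center c))).
  elim: s => [|c s IH]; first by rewrite !big_nil; ring.
  by rewrite !rsum_cons; lra.
exact: aux.
Qed.

Lemma pert_lip f0 f t L0 M x y :
  (forall x y, Rabs (f0 x - f0 y) <= L0 * Rabs (x - y)) ->
  (forall x y, Rabs (f x - f y) <= M * Rabs (x - y)) ->
  Rabs (pert f0 f t x - pert f0 f t y) <= (L0 + eps0 * M * INR D) * Rabs (x - y).
Proof.
move=> h0 h; rewrite pert_sub Rmult_plus_distr_r.
apply: Rle_trans (Rabs_triang _ _) _; apply: Rplus_le_compat => //.
have -> : eps0 * M * INR D * Rabs (x - y) = eps0 * M * Rabs (x - y) * INR D by ring.
apply: rsum_bound_const => c; have := coef_bound t c; rewrite Rabs_mult => hc.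
rewrite (Rabs_right (coef t c)); last lra.
rewrite Rmult_assoc; apply: Rmult_le_compat; [lra|exact: Rabs_pos|lra|].
by apply: Rle_trans (h _ _) _; right; congr (_ * Rabs _); ring.
Qed.

Lemma derivable_pert f0 f0' f f' t x :
  derivable_pt_lim f0 x (f0' x) -> (forall y, derivable_pt_lim f y (f' y)) ->
  derivable_pt_lim (pert f0 f t) x (pert f0' f' t x).
Proof.
move=> h0 h; apply: (derivable_pt_lim_plus f0 (fun x => rsum (c < D) coef t c * f (x - center c))) => //.
elim: (index_enum _) => [|c s IH].
  rewrite big_nil; apply: (derivable_pt_lim_ext (fct_cte 0)) => [y|]; last exact: derivable_pt_lim_const.
  by rewrite big_nil.
rewrite rsum_cons; apply: (derivable_pt_lim_ext
  (plus_fct (mult_real_fct (coef t c) (Ranalysis1.comp f (fun x => Rminus x (center c)))) (fun x => \big[Rplus/0]_(c <- s) (coef t c * f (x - center c))))).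
  by move=> y; rewrite rsum_cons.
apply: derivable_pt_lim_plus => //; apply: derivable_pt_lim_scal.
apply: (@derivable_pt_lim_eq _ _ (f' (x - center c) * (1 - 0))); first ring.
apply: (derivable_pt_lim_comp (fun x => x - center c) f); last exact: h.
exact: (derivable_pt_lim_minus id (fct_cte (center c)) x 1 0 (derivable_pt_lim_id x) (derivable_pt_lim_const _ x)).
Qed.

Lemma pert_per f0 f t : Periodic1 f0 -> Periodic1 f -> Periodic1 (pert f0 f t).
Proof.
move=> h0 h x; rewrite /pert h0; congr (_ + _); apply: eq_bigr => c _.
by have -> : x + 1 - center c = x - center c + 1 by [ring]; rewrite h.
Qed.

Lemma continuity_pert f0 f t : continuity f0 -> continuity f -> continuity (pert f0 f t).
Proof.
move=> h0 h x; apply: (continuity_pt_plus f0 (fun x => rsum (c < D) coef t c * f (x - center c))) => //.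
have ext (g1 g2 : R -> R) : (forall y, g1 y = g2 y) -> continuity_pt g1 x -> continuity_pt g2 x.
  by move=> /functional_extensionality ->.
elim: (index_enum _) => [|c s IH].
  apply: (ext (fct_cte 0)) => [y|]; first by rewrite big_nil.
  by apply: continuity_pt_const => ? ?.
apply: (ext (plus_fct (mult_real_fct (coef t c) (Ranalysis1.comp f (fun x => Rminus x (center c))))
  (fun x => \big[Rplus/0]_(c <- s) (coef t c * f (x - center c))))).
  by move=> y; rewrite rsum_cons.
apply: continuity_pt_plus => //; apply: continuity_pt_scal.
apply: continuity_pt_comp; last exact: h.
apply: derivable_continuous_pt; exists (1 - 0).
exact: (derivable_pt_lim_minus id (fct_cte (center c)) x 1 0 (derivable_pt_lim_id x) (derivable_pt_lim_const _ x)).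
Qed.

Lemma exists_center u : (0 < D)%N -> exists (c : 'I_D) (z : Z), Rabs (u - center c - IZR z) <= / INR D.
Proof.
clear K_gt0; move=> D0; have hD : 0 < INR D by apply: lt_0_INR; lia.
have hz := base_Int_part u; set z := Int_part u in hz.
have h0 : 0 <= (u - IZR z) * INR D by apply: Rmult_le_pos; lra.
have hlt : (natfloor ((u - IZR z) * INR D) < D)%N by apply: natfloor_lt => //; nra.
exists (Ordinal hlt), z; rewrite /center /=.
have := natfloorP h0; set k := INR (natfloor _) => hk.
have -> : u - k / INR D - IZR z = ((u - IZR z) * INR D - k) / INR D by field; lra.
rewrite Rabs_divp // Rabs_right; last lra.
rewrite -[X in _ <= X]Rmult_1_l; apply: Rmult_le_compat_r; last lra.
by left; apply: Rinv_0_lt_compat.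
Qed.

(** Diagonal dominance of the matrix [slopeG (f (- - center (c j))) n (X i)]
    makes the map from parameters to slopes expanding in the sup norm. *)
Lemma pert_separated f0 f p (c : 'I_p -> 'I_D) (X : 'I_p -> R) q n : (0 < p)%N -> injective c ->
  (forall i, dG q (X i) / 4 <= slopeG (fun x => f (x - center (c i))) n (X i)) ->
  (forall i j, i != j ->
     Rabs (slopeG (fun x => f (x - center (c j))) n (X i)) <= / (8 * INR p) * dG q (X i)) ->
  forall t t' : {ffun 'I_D -> 'I_K}, t != t' -> (forall x, x \notin codom c -> t x = t' x) ->
  exists i, eps0 / (8 * INR K) * dG q (X i) <=
    Rabs (slopeG (pert f0 f t) n (X i) - slopeG (pert f0 f t') n (X i)).
Proof.
move=> p0 cinj hdiag hoff t t' ne hcod.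
have hK : 0 < INR K by apply: lt_0_INR; lia.
have hp : 0 < INR p by apply: lt_0_INR; lia.
pose dd (x : 'I_D) := ((t x - t' x) + (t' x - t x))%N.
have ddE x : Rabs (INR (t x) - INR (t' x)) = INR (dd x).
  rewrite /dd; case: (leqP (t x) (t' x)) => h.
    have -> : (t x - t' x = 0)%N by lia.
    by rewrite add0n minus_INR; [rewrite Rabs_minus_sym Rabs_right //; have := INR_leq h; lra | lia].
  have -> : (t' x - t x = 0)%N by lia.
  by rewrite addn0 minus_INR; [rewrite Rabs_right //; have := INR_leq (ltnW h); lra | lia].
have [x0 hx0] : exists x0, t x0 != t' x0.
  apply/existsP; apply: contraR ne; rewrite negb_exists => /forallP h.
  by apply/eqP/ffunP => x; apply/eqP; have := h x; rewrite negbK.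
case: (@arg_maxnP _ x0 xpredT dd isT) => xm _ hmax.
have dm : (0 < dd xm)%N.
  apply: leq_trans (hmax x0 isT); rewrite /dd; have : (t x0 : nat) != t' x0 by [].
  by move=> /eqP h; lia.
have [i ei] : exists i, xm = c i.
  apply/codomP; apply: contraT => /hcod e; move: dm; rewrite /dd e; lia.
exists i; rewrite !slopeG_pert.
set s := fun x => slopeG (fun y => f (y - center x)) n (X i).
have [ek hek] : exists ek, ek = eps0 / INR K by eexists.
have -> : slopeG f0 n (X i) + (rsum (x < D) coef t x * s x) - (slopeG f0 n (X i) + (rsum (x < D) coef t' x * s x))
  = rsum (x < D) ek * (INR (t x) - INR (t' x)) * s x.
  have aux (r : seq 'I_D) : slopeG f0 n (X i) + \big[Rplus/0]_(x <- r) (coef t x * s x) -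
      (slopeG f0 n (X i) + \big[Rplus/0]_(x <- r) (coef t' x * s x)) =
      \big[Rplus/0]_(x <- r) (ek * (INR (t x) - INR (t' x)) * s x).
    elim: r => [|x r IH]; first by rewrite !big_nil; ring.
    rewrite !rsum_cons -IH /coef hek; field; lra.
  exact: aux.
rewrite (rsumD1 xm).
set rest := \big[_/_]_(_ | _) _.
have Dq := dG_gt0 B q (X i).
have e1 : 0 < ek by rewrite hek; apply: Rdiv_lt_0_compat.
have dm1 : 1 <= INR (dd xm) by apply: (INR_leq (a := 1)).
have hrest : Rabs rest <= ek * INR (dd xm) * (/ 8 * dG q (X i)).
  apply: Rle_trans (_ : ek * INR (dd xm) * (/ (8 * INR p) * dG q (X i)) * INR (\sum_(x | x != xm) (x \in codom c)) <= _).
    apply: rsum_bound => x hx; case: (boolP (x \in codom c)) => [/codomP[j ej]|hn]; last first.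
      by rewrite hcod // Rminus_diag Rmult_0_r Rmult_0_l Rabs_R0 Rmult_0_r; lra.
    rewrite Rmult_1_r !Rabs_mult ddE (Rabs_right (ek)); last lra.
    apply: Rmult_le_compat; [|exact: Rabs_pos| |].
    - by apply: Rmult_le_pos; [lra | apply: pos_INR].
    - by apply: Rmult_le_compat_l; [lra | apply: INR_leq; apply: hmax].
    rewrite /s ej; apply: hoff; apply: contraNneq hx => eij; by rewrite ej ei eij.
  rewrite Rmult_assoc; apply: Rmult_le_compat_l; first by nra.
  have hcard : INR (\sum_(x | x != xm) (x \in codom c)) <= INR p.
    apply: INR_leq; apply: leq_trans (_ : #|codom c| <= p)%N; last by rewrite card_codom // card_ord.
    by rewrite -sum1_card [X in (_ <= X)%N]big_mkcond [X in (X <= _)%N]big_mkcond /=; apply: leq_sum => x _; do 2!case: ifP.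
  have -> : / 8 * dG q (X i) = / (8 * INR p) * dG q (X i) * INR p by field; lra.
  apply: Rmult_le_compat_l => //; apply: Rmult_le_pos; last lra.
  by left; apply: Rinv_0_lt_compat; lra.
have hs : dG q (X i) / 4 <= s xm by rewrite /s ei.
have hmain : ek * INR (dd xm) * (dG q (X i) / 4) <= Rabs (ek * (INR (t xm) - INR (t' xm)) * s xm).
  rewrite !Rabs_mult ddE (Rabs_right (ek)); last lra.
  rewrite (Rabs_right (s xm)); last lra.
  by apply: Rmult_le_compat_l => //; apply: Rmult_le_pos; [lra | apply: pos_INR].
set m := _ * _ * s xm in hmain *.
have htri : Rabs m <= Rabs (m + rest) + Rabs rest.
  have {1}-> : m = (m + rest) + - rest by ring.
  by apply: Rle_trans (Rabs_triang _ _) _; rewrite Rabs_Ropp; lra.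
have -> : eps0 / (8 * INR K) * dG q (X i) = ek * 1 * (dG q (X i) / 8) by rewrite hek; field; lra.
have : ek * 1 * (dG q (X i) / 8) <= ek * INR (dd xm) * (dG q (X i) / 8).
  by apply: Rmult_le_compat_r; [lra | apply: Rmult_le_compat_l; lra].
set u := ek * INR (dd xm) in hrest hmain *.
lra.
Qed.

End Family.

(** * Most parameters are good *)
Section Core.
Variable B : expanding_lift.
Local Notation E := (Emap B).
Local Notation G := (Einv B).
Local Notation l := (degree B).
Local Notation Q := (maxexp B).
Local Notation lam := (minexp B).
Local Notation dG := (dG B).
Local Notation slopeG := (slopeG B).
Let lam_gt1 : 1 < lam := minexp_gt1 B.

Variables (p q J D : nat) (eps0 : R) (f0 f : R -> R).
Variables (kappa delta eta A L th : R).
Hypotheses (p_gt0 : (0 < p)%N) (q_gt0 : (0 < q)%N) (D_gt0 : (0 < D)%N) (eps0_gt0 : 0 < eps0).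
Let K := (Q ^ (J * q))%N.
Let beta := / (8 * INR p).

Hypothesis f0_per : Periodic1 f0.
Hypothesis f_per : Periodic1 f.
Hypothesis kappa_ge0 : 0 <= kappa <= 1.
Hypothesis f_range : forall x, - kappa <= f x <= 1.
Hypothesis f_far : forall x, (forall z, delta <= Rabs (x - IZR z)) -> f x <= kappa.
Hypothesis f_near : forall x, Rabs x <= eta -> 1 / 2 <= f x.
Hypothesis delta_def : delta = / INR Q ^ q * / INR Q ^ q / 4.
Hypothesis D_delta : / INR D <= delta.
Hypothesis D_eta : / INR D <= eta.
Hypothesis kappa_beta : kappa * INR Q ^ q / (lam - 1) <= beta / 2.
Hypothesis q_beta : / lam ^ q / (lam - 1) <= beta / 2.

Local Notation param := {ffun 'I_D -> 'I_K}.
Local Notation psi := (pert eps0 f0 f).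

Hypothesis psi_A : forall (t : param) x, Rabs (psi t x) <= A.
Hypothesis psi_L : forall (t : param) x y, Rabs (psi t x - psi t y) <= L * Rabs (x - y).
Hypothesis th_ge0 : 0 <= th.

Let Theta := th * Cdist B + lipS B A L + 1.
Variables (Nb Cw H : nat).
Hypothesis Nb_ge : A / (lam - 1) + th <= INR Nb.
Hypothesis Cw_ge : (16 * Theta / eps0 + 1) * Cdist B <= INR Cw.
Hypothesis H_gt0 : (0 < H)%N.
Hypothesis H_large : (J * K * (2 * Nb * K).+1 * (l ^ q) ^ p * Cw ^ p < H ^ p)%N.

Lemma K_gt0 : (0 < K)%N.
Proof. by rewrite expn_gt0; have := INR_lt 0 _ (Rlt_trans _ _ _ Rlt_0_1 (Q_gt1 B)); lia. Qed.

Lemma INR_K : INR K = INR Q ^ (J * q).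
Proof. exact: INR_expn. Qed.

Lemma K_ge1 : 1 <= INR K.
Proof. exact: INR_leq K_gt0. Qed.

Lemma invK_le_dG n X : (n <= J * q)%N -> / INR K <= dG n X.
Proof.
move=> hn; apply: Rle_trans (dG_ge B n X); rewrite INR_K; have hQ := Q_gt1 B.
apply: Rinv_le_contravar; first by apply: pow_lt; lra.
by apply: Rle_pow; [lra | lia].
Qed.

Lemma psiZ (t : param) x (z : Z) : psi t (x + IZR z) = psi t x.
Proof. by apply: (@Periodic1_Z R (psi t)); apply: pert_per. Qed.

Lemma A_nonneg : 0 <= A.
Proof.
have hK := K_gt0; pose t : param := [ffun=> Ordinal hK].
by have := psi_A t 0; have := Rabs_pos (psi t 0); lra.
Qed.

Lemma L_nonneg : 0 <= L.
Proof.
have hK := K_gt0; pose t : param := [ffun=> Ordinal hK].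
have := psi_L t 1 0; have := Rabs_pos (psi t 1 - psi t 0); rewrite Rminus_0_r Rabs_R1; lra.
Qed.

Lemma lipS_nonneg : 0 <= lipS B A L.
Proof.
have h1 := A_nonneg; have h2 := L_nonneg; have h3 := lipE1_ge0 B.
have h4 : 0 <= A / (lam - 1) by apply: Rle_mult_inv_pos; lra.
apply: Rle_mult_inv_pos; nra.
Qed.

Lemma Theta_gt0 : 0 < Theta.
Proof. have := lipS_nonneg; have := Cdist_ge1 B; rewrite /Theta; nra. Qed.

Definition unlinked x (a b : nat) := forall k, (k <= q)%N ->
  ~ near B (2 * INR Q ^ q * delta) k (iter q G (x + INR a)) (iter q G (x + INR b)).

Definition ncell (Y : R) (m : nat) : nat := (natfloor (16 * Theta * INR K / eps0 * dG m Y)).+1.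

Lemma ncell_bounds Y m : (m <= J * q)%N ->
  16 * Theta * INR K / eps0 * dG m Y < INR (ncell Y m) /\
  INR (ncell Y m) <= INR K * (16 * Theta / eps0 + 1) * dG m Y.
Proof.
move=> hm; have hT := Theta_gt0; have hK := K_ge1; have hD := dG_gt0 B m Y.
have h0 : 0 <= 16 * Theta * INR K / eps0 * dG m Y.
  by apply: Rmult_le_pos; [apply: Rle_mult_inv_pos; nra | lra].
rewrite /ncell S_INR; have [h1 h2] := natfloorP h0.
split=> //.
have : 1 <= INR K * dG m Y.
  have := invK_le_dG Y hm => h; have := Rmult_le_compat_l (INR K) _ _ ltac:(lra) h.
  by rewrite Rinv_r; lra.
have -> : INR K * (16 * Theta / eps0 + 1) * dG m Y = 16 * Theta * INR K / eps0 * dG m Y + INR K * dG m Y by field; lra.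
lra.
Qed.

Lemma sum_ncell Y m : (m <= J * q)%N -> (\sum_(b < l ^ m) ncell (Y + INR b) m <= K * Cw)%N.
Proof.
move=> hm; have hT := Theta_gt0; have hK := K_ge1.
have C0 : 0 <= INR K * (16 * Theta / eps0 + 1).
  have : 0 < 16 * Theta / eps0 by apply: Rdiv_lt_0_compat; lra.
  by move=> h; apply: Rmult_le_pos; lra.
have := @sum_dG_full B m Y (fun b => ncell (Y + INR b) m) _ C0 (fun b => proj2 (ncell_bounds _ hm)).
move=> h; apply/leP; apply: INR_le; rewrite mult_INR; apply: Rle_trans h _.
by rewrite Rmult_assoc; apply: Rmult_le_compat_l; lra.
Qed.

Lemma near0_of_close u v c z z' : Rabs (u - c - IZR z) <= / INR D ->
  Rabs (v - c - IZR z') <= / INR D -> near B (2 * INR Q ^ q * delta) 0 u v.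
Proof.
move=> h1 h2; exists (z - z')%Z; rewrite minus_IZR /=.
have -> : u - v - (IZR z - IZR z') = (u - c - IZR z) - (v - c - IZR z') by ring.
apply: Rle_lt_trans (Rabs_triang _ _) _; rewrite Rabs_Ropp.
have hQ := Q_gt1 B.
have : 1 < INR Q ^ q by apply: Rlt_pow_R1 => //; lia.
have : 0 < / INR D by apply: Rinv_0_lt_compat; apply: lt_0_INR; lia.
nra.
Qed.

Lemma count_hits_box (m : nat) (x0 s0 : R) (a : 'I_p -> 'I_(l ^ q)) (b : 'I_p -> nat) :
  (q + m <= J * q)%N ->
  (forall i j, i != j -> unlinked x0 (a i) (a j)) ->
  (#|[set t : param | [forall i, hit B (psi t) Theta (q + m) s0
       (x0 + INR (a i) + INR (b i) * INR l ^ q)%Re]]| * K ^ p <=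
   K ^ D * \prod_i ncell (iter q G (x0 + INR (a i))%Re + INR (b i))%Re m)%N.
Proof.
move=> hm hun; set n := (q + m)%N.
have hT := Theta_gt0; have hK := K_ge1.
pose u i := iter q G (x0 + INR (a i)).
pose X i := x0 + INR (a i) + INR (b i) * INR l ^ q.
have hX i : iter q G (X i) = u i + IZR (Z.of_nat (b i)).
  by rewrite /X (INR_IZR_INZ (b i)) iterG_addZ.
have hdq i : dG q (X i) = dG q (x0 + INR (a i)) by rewrite /X (INR_IZR_INZ (b i)) dG_per.
have [c hc] : exists c : 'I_p -> 'I_D, forall i, exists z, Rabs (u i - center (c i) - IZR z) <= / INR D.
  exists (fun i => proj1_sig (constructive_indefinite_description _ (exists_center (u i) D_gt0))).
  by move=> i; case: constructive_indefinite_description.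
have cinj : injective c.
  move=> i j e; apply/eqP; apply: contraT => /hun /(_ 0%N isT); case.
  have [z hz] := hc i; have [z' hz'] := hc j; rewrite e in hz.
  exact: near0_of_close hz hz'.
have delta0 : 0 < delta.
  have : 0 < / INR Q ^ q by apply: Rinv_0_lt_compat; apply: pow_lt; have := Q_gt1 B; lra.
  by rewrite delta_def => h; nra.
have p1 : 1 <= INR p by apply: (INR_leq (a := 1)).
have beta1 : beta / 2 <= 1 / 4.
  have : beta <= / 8 by apply: Rinv_le_contravar; lra.
  lra.
have fZ := Periodic1_Z f_per.
have hdiag i : dG q (X i) / 4 <= slopeG (fun x => f (x - center (c i))) n (X i).
  apply: (@slopeG_diag B (fun x => f (x - center (c i))) kappa); [by rewrite /n; lia | lra | | | lra].
    by move=> x; have := f_range (x - center (c i)); lra.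
  have [z hz] := hc i; rewrite hX.
  have -> : u i + IZR (Z.of_nat (b i)) - center (c i) = u i - center (c i) - IZR z + IZR (z + Z.of_nat (b i)) by rewrite plus_IZR; ring.
  by rewrite fZ; apply: f_near; lra.
have hoff i j : i != j ->
     Rabs (slopeG (fun x => f (x - center (c j))) n (X i)) <= beta * dG q (X i).
  move=> hij; apply: (@slopeG_offdiag B (fun x => f (x - center (c j))) kappa) => //; try lra.
  - by rewrite /n; lia.
  - by move=> x; apply: Rabs_le; have := f_range (x - center (c j)); lra.
  move=> k hk; apply: Rabs_le.
  have := f_range (iter k G (X i) - center (c j)).
  suff : f (iter k G (X i) - center (c j)) <= kappa by lra.
  apply: f_far => w.
  apply: (@orbit_far B q delta x0 (a i) (a j) (X i) (Z.of_nat (b i))) => //.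
  + exact: hun.
  + by apply: hun; rewrite eq_sym.
  have [z hz] := hc j; exists z; apply: Rle_trans hz _; lra.
have hDn i : dG n (X i) = dG q (X i) * dG m (u i + INR (b i)).
  by rewrite /n dG_add hX -INR_IZR_INZ.
apply: (@count_box D K p c (fun i t => slopeG (psi t) n (X i)) _
  (fun i => eps0 / (8 * INR K) * dG q (X i)) (fun i => s0 - Theta * dG n (X i))) => //.
- move=> i; apply: Rmult_lt_0_compat; last exact: dG_gt0.
  by apply: Rdiv_lt_0_compat; lra.
- exact: (@pert_separated B D K eps0 K_gt0 eps0_gt0 f0 f p c X q n p_gt0 cinj hdiag hoff).
move=> t i; rewrite inE => /forallP /(_ i) /RlebP; rewrite -/(X i) => /Rabs_le_between ht.
split; first lra.
have [hcell _] := @ncell_bounds (u i + INR (b i)) m ltac:(lia).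
apply: Rle_lt_trans (_ : 2 * Theta * dG n (X i) < _); first lra.
rewrite hDn -/(u i).
have dq := dG_gt0 B q (X i).
have e : 0 < eps0 / (8 * INR K) * dG q (X i).
  by apply: Rmult_lt_0_compat => //; apply: Rdiv_lt_0_compat; lra.
have := Rmult_lt_compat_l _ _ _ e hcell.
have -> : eps0 / (8 * INR K) * dG q (X i) * (16 * Theta * INR K / eps0 * dG m (u i + INR (b i)))
  = 2 * Theta * (dG q (X i) * dG m (u i + INR (b i))) by field; lra.
done.
Qed.

Definition bad (j : nat) (x0 s0 : R) (a : 'I_p -> 'I_(l ^ q)) : {set param} :=
  [set t : param | [forall i, H <= \sum_(b < l ^ (j * q)) hit B (psi t) Theta (q + j * q) s0
       (x0 + INR (a i) + INR b * INR l ^ q)%Re]]%N.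

Lemma card_bad j x0 s0 (a : 'I_p -> 'I_(l ^ q)) : (j < J)%N ->
  (forall i k, i != k -> unlinked x0 (a i) (a k)) ->
  (#|bad j x0 s0 a| * H ^ p <= K ^ D * Cw ^ p)%N.
Proof.
move=> hj hun; have hm : (q + j * q <= J * q)%N by rewrite -mulSn leq_mul2r hj orbT.
apply: (@moment_bound _ p (l ^ (j * q)) K D Cw H
  (fun t i b => hit B (psi t) Theta (q + j * q) s0 (x0 + INR (a i) + INR b * INR l ^ q))
  (fun i b => ncell (iter q G (x0 + INR (a i)) + INR b) (j * q)) K_gt0).
  move=> b; exact: (@count_hits_box (j * q) x0 s0 a (fun i => b i)).
by move=> i; apply: sum_ncell; lia.
Qed.

Definition witness : finType :=
  ('I_J * 'I_K * 'I_(2 * Nb * K).+1 * {ffun 'I_p -> 'I_(l ^ q)})%type.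

Definition grid_x (w : witness) : R := INR w.1.1.2 / INR K.
Definition grid_s (w : witness) : R := INR w.1.2 / INR K - INR Nb.

Definition admissible (w : witness) : bool :=
  decideb (forall i k, i != k -> unlinked (grid_x w) (w.2 i) (w.2 k)).

Definition bad_at (w : witness) : {set param} := bad w.1.1.1 (grid_x w) (grid_s w) w.2.

Lemma exists_not_bad : exists t : param, forall w, admissible w -> t \notin bad_at w.
Proof.
apply: Classical_Prop.NNPP => hn.
have hcov t : exists w, admissible w && (t \in bad_at w).
  apply: Classical_Prop.NNPP => h; case: hn; exists t => w hw; apply/negP => hb.
  by case: h; exists w; rewrite hw.
have h1 : (K ^ D <= \sum_(w : witness | admissible w) #|bad_at w|)%N.
  have -> : (K ^ D = \sum_(t : param) 1)%N by rewrite sum1_card card_ffun !card_ord.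
  rewrite (eq_bigr (fun w : witness => \sum_(t : param) (t \in bad_at w))%N); last first.
    by move=> w _; rewrite -sum1_card big_mkcond /=; apply: eq_bigr => t _; case: (t \in _).
  rewrite exchange_big /=; apply: leq_sum => t _.
  by have [w /andP[hw ht]] := hcov t; rewrite (bigD1 w) //= ht.
have h2 : (\sum_(w : witness | admissible w) #|bad_at w| * H ^ p <= #|witness| * (K ^ D * Cw ^ p))%N.
  rewrite -sum_nat_const big_mkcond /=; apply: leq_sum => w _; case: ifP => // /decidebP hw.
  exact: card_bad.
rewrite -big_distrl /= in h2.
have K0 := K_gt0.
have h3 : (K ^ D * H ^ p <= K ^ D * (#|witness| * Cw ^ p))%N.
  apply: leq_trans (_ : (\sum_(w : witness | admissible w) #|bad_at w|) * H ^ p <= _)%N.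
    by rewrite leq_mul2r h1 orbT.
  by apply: leq_trans h2 _; rewrite mulnCA.
have : (H ^ p <= #|witness| * Cw ^ p)%N by rewrite leq_pmul2l in h3 => //; rewrite expn_gt0 K0.
rewrite !card_prod !card_ord card_ffun !card_ord leqNgt.
by rewrite H_large.
Qed.

Lemma grid_point (y : R) (N : nat) : 0 <= y < INR N ->
  exists i : 'I_(N * K), 0 <= y - INR i / INR K <= / INR K.
Proof.
move=> hy; have hK := K_ge1.
have h0 : 0 <= y * INR K by nra.
have hlt : (natfloor (y * INR K) < N * K)%N by apply: natfloor_lt => //; rewrite mult_INR; nra.
exists (Ordinal hlt) => /=; have := natfloorP h0; set k := INR (natfloor _) => hk.
have -> : y - k / INR K = (y * INR K - k) * / INR K by field; lra.
have hi : 0 < / INR K by apply: Rinv_0_lt_compat; lra.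
nra.
Qed.

Lemma hit_transfer (t : param) n s s0 x x0 Y : (n <= J * q)%N ->
  Rabs (s - s0) <= / INR K -> Rabs (x - x0) <= / INR K ->
  hit B (psi t) th n s (x + Y) -> hit B (psi t) Theta n s0 (x0 + Y).
Proof.
move=> hn hs hx /RlebP h; apply/RlebP.
have hK := invK_le_dG (x0 + Y) hn.
have hlip := slopeG_lip B n (x + Y) (x0 + Y) (psi_A t) (psi_L t).
have hdist := dG_distort B n (x + Y) (x0 + Y).
have exy : x + Y - (x0 + Y) = x - x0 by ring.
rewrite exy in hlip hdist.
have K1 : / INR K <= 1 by rewrite -Rinv_1; apply: Rinv_le_contravar; [lra | exact: K_ge1].
have hC : exp (dist_c B * Rabs (x - x0)) <= Cdist B.
  apply: exp_le; have := dist_c_ge0 B; have := Rabs_pos (x - x0); nra.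
have D0 := dG_gt0 B n (x0 + Y).
have e1 : th * dG n (x + Y) <= th * Cdist B * dG n (x0 + Y).
  rewrite Rmult_assoc; apply: Rmult_le_compat_l => //; apply: Rle_trans hdist _.
  by rewrite Rmult_comm; apply: Rmult_le_compat_r; lra.
have e2 : lipS B A L * Rabs (x - x0) <= lipS B A L * dG n (x0 + Y).
  by apply: Rmult_le_compat_l; [exact: lipS_nonneg | lra].
have -> : s0 - slopeG (psi t) n (x0 + Y) = - (s - s0) + ((s - slopeG (psi t) n (x + Y)) + (slopeG (psi t) n (x + Y) - slopeG (psi t) n (x0 + Y))) by ring.
apply: Rle_trans (Rabs_triang _ _) _; rewrite Rabs_Ropp.
have := Rabs_triang (s - slopeG (psi t) n (x + Y)) (slopeG (psi t) n (x + Y) - slopeG (psi t) n (x0 + Y)).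
rewrite /Theta; lra.
Qed.

Lemma exists_good : exists t : param, forall x s,
  (hits B (psi t) th (J * q) x s <= (2 * (q.+1.*2.+1 * p)) ^ J * (l ^ q * H))%N.
Proof.
have [t ht] := exists_not_bad; exists t.
set P := (q.+1.*2.+1 * p)%N.
have P0 : (0 < P)%N by rewrite muln_gt0.
move=> x' s'; apply: (@hits_not_rich B (psi t) th (@psiZ t) q P H J) => // {x' s'} j x s hj hx.
rewrite leqNgt; apply/negP => hrich.
have hn : (q + j * q <= J * q)%N by rewrite -mulSn leq_mul2r hj orbT.
set Rs := rich_classes _ _ _ _ _ _ _ _ in hrich.
have hK := K_ge1.
have hs : Rabs s <= INR Nb.
  have /card_gt0P[a] : (0 < #|Rs|)%N by apply: leq_trans hrich.
  rewrite inE => ha.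
  have [b hb] : exists b : 'I_(l ^ (j * q)), hit B (psi t) th (q + j * q) s (x + INR a + INR b * INR l ^ q).
    apply/existsP; apply: contraT; rewrite negb_exists => /forallP h.
    move: ha; rewrite big1; first by rewrite leqNgt H_gt0.
    by move=> b _; rewrite (negbTE (h b)).
  move/RlebP: hb; set X := x + _ + _ => hb.
  have h1 := slopeG_bound B (q + j * q) X (psi_A t).
  have h2 := dG_le1 B (q + j * q) X; have h3 := dG_gt0 B (q + j * q) X.
  have {1}-> : s = (s - slopeG (psi t) (q + j * q) X) + slopeG (psi t) (q + j * q) X by ring.
  apply: Rle_trans (Rabs_triang _ _) _; nra.
have [ix hix] := @grid_point x 1 ltac:(rewrite /=; lra).
have hs' := Rabs_le_between hs.
have [is_ his] : exists i : 'I_(2 * Nb * K).+1, 0 <= (s + INR Nb) - INR i / INR K <= / INR K.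
  have h0 : 0 <= (s + INR Nb) * INR K by nra.
  have hlt : (natfloor ((s + INR Nb) * INR K) < (2 * Nb * K).+1)%N.
    apply: natfloor_lt => //; rewrite S_INR !mult_INR /=; nra.
  exists (Ordinal hlt) => /=; have := natfloorP h0; set k := INR (natfloor _) => hk.
  have -> : s + INR Nb - k / INR K = ((s + INR Nb) * INR K - k) * / INR K by field; lra.
  have hi : 0 < / INR K by apply: Rinv_0_lt_compat; lra.
  nra.
have ltK : (ix < K)%N by rewrite -[X in (_ < X)%N]mul1n.
pose x0 := INR ix / INR K; pose s0 := INR is_ / INR K - INR Nb.
have hd : 2 * INR Q ^ q * delta <= / INR Q ^ q / 2.
  rewrite delta_def; right; field; apply: pow_nonzero; have := Q_gt1 B; lra.
have [sq [sz su ss sl]] := @independent_set _ (@linked B q (2 * INR Q ^ q * delta) x0) q.+1 p Rs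
  (fun a _ => linked_outdeg x0 Rs a hd) (ltnW hrich).
pose a : {ffun 'I_p -> 'I_(l ^ q)} := [ffun i : 'I_p => tnth (Tuple (introT eqP sz)) i].
have ain i : a i \in sq by rewrite ffunE; apply: mem_tnth.
have ainj i k : i != k -> a i != a k.
  move=> hik; apply: contraNneq hik; rewrite !ffunE => /eqP.
  have /tuple_uniqP h : uniq (Tuple (introT eqP sz)) by [].
  by move=> /eqP /h ->.
pose w : witness := (Ordinal hj, Ordinal ltK, is_, a).
have hw : admissible w.
  apply/decidebP => i k hik m hm hnear.
  have := sl _ _ (ain i) (ain k) (ainj _ _ hik); rewrite /linked ainj //= => /existsP; case.
  have hm' : (m < q.+1)%N by [].
  by exists (Ordinal hm'); apply/decidebP.
case/negP: (ht w hw); rewrite inE; apply/forallP => i.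
have := ss _ (ain i); rewrite inE => hH; apply: leq_trans hH _.
apply: leq_sum => b _; case hb : hit => //.
suff -> : hit B (psi t) Theta (q + j * q) s0 (x0 + INR (a i) + INR b * INR l ^ q) by [].
rewrite Rplus_assoc; apply: (hit_transfer (s := s) (x := x)) => //.
- by rewrite /s0 Rabs_right; lra.
- by rewrite /x0 Rabs_right; lra.
by rewrite -Rplus_assoc.
Qed.

End Core.

(** * Density *)

Lemma pow_beats_linear (a b : R) : 1 < a -> 0 <= b -> exists N, forall n, (N <= n)%N ->
  b * (INR n + 1) <= a ^ n.
Proof.
move=> ha hb; set s := sqrt a.
have hs : s * s = a by apply: sqrt_sqrt; lra.
have s1 : 1 < s by rewrite -sqrt_1; apply: sqrt_lt_1; lra.
set c := Rmin 1 (s - 1).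
have c0 : 0 < c by apply: Rmin_glb_lt; lra.
have [N hN] := pow_unbounded (b / c) s1; exists N => n hn.
have h1 := hN n hn.
have h2 : c * (INR n + 1) <= s ^ n.
  have := poly n (s - 1) ltac:(lra); have -> : 1 + (s - 1) = s by ring.
  have := Rmin_l 1 (s - 1); have := Rmin_r 1 (s - 1); rewrite -/c => r1 r2.
  have := pos_INR n; nra.
rewrite -hs Rpow_mult_distr.
have -> : b * (INR n + 1) = (b / c) * (c * (INR n + 1)) by field; lra.
apply: Rmult_le_compat => //; first by apply: Rle_mult_inv_pos.
by apply: Rmult_le_pos; [lra | have := pos_INR n; lra].
Qed.

Lemma lipschitz_of_deriv (f f' : R -> R) M : (forall x, derivable_pt_lim f x (f' x)) ->
  (forall x, Rabs (f' x) <= M) -> forall x y, Rabs (f x - f y) <= M * Rabs (x - y).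
Proof.
move=> hd hM.
have aux x y : x < y -> Rabs (f x - f y) <= M * Rabs (x - y).
  move=> xy; have pr z : derivable_pt f z by exists (f' z); apply: hd.
  have [c [hc _]] := MVT_cor1 f x y (fun z => pr z) xy.
  rewrite (Rabs_minus_sym (f x)) (Rabs_minus_sym x) hc Rabs_mult.
  apply: Rmult_le_compat_r; first exact: Rabs_pos.
  suff -> : derive_pt f c (pr c) = f' c by [].
  by apply: (uniqueness_limite f c _ _ _ (hd c)); apply: derive_pt_eq_1 (erefl _).
move=> x y; case: (Rtotal_order x y) => [/aux//|[->|/aux]].
  by rewrite !Rminus_diag Rabs_R0; lra.
by rewrite Rabs_minus_sym (Rabs_minus_sym x).
Qed.

Lemma common_bound (g : nat -> R -> R) r :
  (forall k, (k <= r)%N -> exists M, forall x, Rabs (g k x) <= M) ->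
  exists2 M, 1 <= M & forall k x, (k <= r)%N -> Rabs (g k x) <= M.
Proof.
elim: r => [|r IH] h.
  have [M hM] := h 0%N isT; exists (Rmax 1 M); first exact: Rmax_l.
  by move=> [|k] // x _; apply: Rle_trans (hM x) (Rmax_r _ _).
have [|M M1 hM] := IH; first by move=> k hk; apply: h; lia.
have [M' hM'] := h r.+1 (leqnn _); exists (Rmax M M').
  by apply: Rle_trans M1 (Rmax_l _ _).
move=> k x; rewrite leq_eqVlt => /orP[/eqP ->|hk].
  exact: Rle_trans (hM' x) (Rmax_r _ _).
by apply: Rle_trans (Rmax_l _ _); apply: hM.
Qed.

Lemma exists_nat_ge (x : R) : exists n : nat, x <= INR n.
Proof. by have [n hn] := INR_unbounded x; exists n; lra. Qed.

Section Density.
Variable B : expanding_lift.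
Local Notation l := (degree B).
Local Notation Q := (maxexp B).
Local Notation lam := (minexp B).
Let lam_gt1 : 1 < lam := minexp_gt1 B.
Let Q_gt1 : 1 < INR Q := Q_gt1 B.

Lemma choose_pqh rho : 1 < rho -> exists p q h : nat,
  [/\ (0 < p)%N, (0 < q)%N,
      / lam ^ q / (lam - 1) <= / (8 * INR p) / 2,
      (4 * (Q ^ q) ^ 2 <= h ^ p)%N &
      4 * INR (q.+1.*2.+1 * p) * INR h <= rho ^ q].
Proof.
move=> hrho; set mu := sqrt rho.
have hmu : mu * mu = rho by apply: sqrt_sqrt; lra.
have mu1 : 1 < mu by rewrite -sqrt_1; apply: sqrt_lt_1; lra.
have [p0 hp0] := pow_unbounded (4 * INR Q ^ 2) mu1.
pose p := p0.+1; have hp := hp0 p (leqnSn _).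
have p1 : 1 <= INR p by apply: (INR_leq (a := 1)).
have [q1 hq1] := pow_beats_linear (b := 8 * (3 * INR p)) mu1 ltac:(lra).
have [q2 hq2] := pow_unbounded (16 * INR p / (lam - 1)) lam_gt1.
pose q := (q1 + q2).+1.
have {}hq1 := hq1 q ltac:(rewrite /q; lia); have {}hq2 := hq2 q ltac:(rewrite /q; lia).
have mq : 1 <= mu ^ q by apply: pow_R1_Rle; lra.
pose h := (natfloor (mu ^ q)).+1.
have [h1 h2] := natfloorP (x := mu ^ q) ltac:(lra).
have hh : INR h = INR (natfloor (mu ^ q)) + 1 by rewrite /h S_INR.
exists p, q, h; split=> //.
- have pl : 0 < lam ^ q by apply: pow_lt; lra.
  apply: (Rmult_le_reg_r (lam ^ q)) => //.
  have -> : / lam ^ q / (lam - 1) * lam ^ q = / (lam - 1) by field; lra.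
  apply: (Rmult_le_reg_l (16 * INR p)); first lra.
  have -> : 16 * INR p * (/ (8 * INR p) / 2 * lam ^ q) = lam ^ q by field; lra.
  exact: hq2.
- apply/leP; apply: INR_le; rewrite mult_INR !INR_expn.
  apply: Rle_trans (_ : (mu ^ q) ^ p <= _); last by apply: pow_incr; lra.
  have -> : (mu ^ q) ^ p = (mu ^ p) ^ q by rewrite -!pow_mult Nat.mul_comm.
  apply: Rle_trans (_ : (4 * INR Q ^ 2) ^ q <= _); last by apply: pow_incr; split => //; nra.
  rewrite Rpow_mult_distr -!pow_mult (Nat.mul_comm 2).
  apply: Rmult_le_compat_r; first by apply: pow_le; lra.
  have -> : INR 4 = 4 ^ 1 by rewrite /=; ring.
  by apply: Rle_pow; [lra | rewrite /q; lia].
rewrite -hmu Rpow_mult_distr.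
have e : INR (q.+1.*2.+1 * p) = (2 * INR q + 3) * INR p.
  by rewrite mult_INR S_INR INR_double S_INR; ring.
have q0 := pos_INR q.
have : 4 * INR (q.+1.*2.+1 * p) * 2 <= mu ^ q by rewrite e; nra.
have : 0 <= INR (q.+1.*2.+1 * p) by apply: pos_INR.
set c := INR (_ * p); nra.
Qed.

Lemma choose_J rho p q h (Nb Cw : nat) : (0 < p)%N -> (0 < q)%N ->
  (4 * (Q ^ q) ^ 2 <= h ^ p)%N ->
  4 * INR (q.+1.*2.+1 * p) * INR h <= rho ^ q -> exists J : nat,
  [/\ (0 < J)%N, (0 < h ^ J)%N,
   (J * (Q ^ (J * q)) * (2 * Nb * (Q ^ (J * q))).+1 * (l ^ q) ^ p * Cw ^ p < (h ^ J) ^ p)%N &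
   INR ((2 * (q.+1.*2.+1 * p)) ^ J * (l ^ q * h ^ J)) < rho ^ (J * q)].
Proof.
move=> p0 q0 hh hP.
have Q0 : (0 < Q)%N by apply/ltP; apply: INR_lt; rewrite /=; lra.
have h0 : (0 < h)%N.
  have : (0 < h ^ p)%N by apply: leq_trans hh; rewrite muln_gt0 !expn_gt0 Q0.
  by rewrite expn_gt0 => /orP[//|/eqP e]; rewrite e in p0.
pose C1 := ((2 * Nb).+1 * (l ^ q) ^ p * Cw ^ p)%N.
pose J := (C1 + l ^ q).+1; exists J.
have hJ0 : (0 < h ^ J)%N by rewrite expn_gt0 h0.
have C2 : (C1 < 2 ^ J)%N.
  by apply: ltn_trans (ltn_expl C1 (ltnSn 1)) _; rewrite ltn_exp2l // /J; lia.
have lq2 : (l ^ q < 2 ^ J)%N.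
  by apply: ltn_trans (ltn_expl (l ^ q) (ltnSn 1)) _; rewrite ltn_exp2l // /J; lia.
split=> //.
  set K := (Q ^ (J * q))%N.
  have K0 : (0 < K)%N by rewrite expn_gt0 Q0.
  have e1 : ((2 * Nb * K).+1 <= (2 * Nb).+1 * K)%N by rewrite mulSn; lia.
  have e2 : (4 ^ J * K ^ 2 <= (h ^ J) ^ p)%N.
    have -> : ((h ^ J) ^ p = (h ^ p) ^ J)%N by rewrite -!expnM mulnC.
    have -> : (4 ^ J * K ^ 2 = (4 * (Q ^ q) ^ 2) ^ J)%N.
      by rewrite expnMn -!expnM; congr (_ * _ ^ _)%N; lia.
    by rewrite leq_exp2r.
  apply: leq_trans e2.
  have -> : (4 ^ J = 2 ^ J * 2 ^ J)%N by rewrite -expnMn.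
  apply: leq_ltn_trans (_ : J * C1 * K ^ 2 < _)%N.
    apply: leq_trans (_ : J * K * ((2 * Nb).+1 * K) * (l ^ q) ^ p * Cw ^ p <= _)%N.
      by rewrite !leq_mul2r; do 2!(apply/orP; right); rewrite leq_mul2l e1 orbT.
    by rewrite /C1; apply: eq_leq; nia.
  rewrite ltn_pmul2r; last by rewrite sqrn_gt0.
  by apply: ltn_mul => //; apply: ltn_expl.
set P := (q.+1.*2.+1 * p)%N in hP *.
have P0 : (0 < P)%N by rewrite muln_gt0.
clearbody P.
apply: (Rlt_le_trans _ ((4 * INR P * INR h) ^ J)); last first.
  have -> : rho ^ (J * q) = (rho ^ q) ^ J by rewrite -pow_mult; congr (_ ^ _); lia.
  apply: pow_incr; split => //.
  by apply: Rmult_le_pos; [have := pos_INR P; lra | apply: pos_INR].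
have -> : (4 * INR P * INR h) ^ J = INR ((2 * P) ^ J * (2 ^ J * h ^ J)).
  by rewrite !mult_INR !INR_expn mult_INR -!Rpow_mult_distr; congr (_ ^ _); have -> : INR 2 = 2 by []; ring.
apply: lt_INR; apply/ltP; rewrite ltn_pmul2l; last by rewrite expn_gt0 muln_gt0 P0.
by rewrite ltn_pmul2r.
Qed.

Lemma small_growth_dense r rho : (2 <= r)%N -> 1 < rho -> DenseCr r (small_growth B r rho).
Proof.
move=> hr hrho tau eps [[d hd] htau] heps.
have dper k : (k <= r)%N -> Periodic1 (d k) by apply: DerivSeq_periodic htau hd.
have dder k x : (k < r)%N -> derivable_pt_lim (d k) x (d k.+1 x).
  by case: hd => _ [h _] hk; apply: h; apply/ltP.
have [MA MA1 hMA] : exists2 M, 1 <= M & forall k x, (k <= r)%N -> Rabs (d k x) <= M.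
  apply: common_bound => k hk; have [x0 hx0] := periodic_abs_max (DerivSeq_continuity hk hd) (dper k hk).
  by exists (Rabs (d k x0)).
have [p [q [h [p0 q0 hq hh hP]]]] := choose_pqh hrho.
have Qq1 : 1 < INR Q ^ q by apply: Rlt_pow_R1 => //; lia.
have p1 : 1 <= INR p by apply: (INR_leq (a := 1)).
set beta := / (8 * INR p) in hq.
have beta0 : 0 < beta by apply: Rinv_0_lt_compat; lra.
set delta := / INR Q ^ q * / INR Q ^ q / 4.
have hdelta : 0 < delta <= 1 / 2.
  have i0 : 0 < / INR Q ^ q by apply: Rinv_0_lt_compat; lra.
  have i1 : / INR Q ^ q < 1 by rewrite -Rinv_1; apply: Rinv_lt_contravar; lra.
  by rewrite /delta; split; nra.
set kappa := Rmin (1 / 4) (beta / 2 * (lam - 1) / INR Q ^ q).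
have hkappa : 0 < kappa <= 1 / 4.
  split; last exact: Rmin_l.
  apply: Rmin_glb_lt; first lra.
  by apply: Rdiv_lt_0_compat; nra.
have kbeta : kappa * INR Q ^ q / (lam - 1) <= beta / 2.
  have := Rmin_r (1 / 4) (beta / 2 * (lam - 1) / INR Q ^ q); rewrite -/kappa => hk.
  apply: (Rmult_le_reg_r ((lam - 1) / INR Q ^ q)); first by apply: Rdiv_lt_0_compat; lra.
  have -> : kappa * INR Q ^ q / (lam - 1) * ((lam - 1) / INR Q ^ q) = kappa by field; lra.
  by have -> : beta / 2 * ((lam - 1) / INR Q ^ q) = beta / 2 * (lam - 1) / INR Q ^ q by field; lra.
have [phi [phider [phiper [phirange [phifar [eta eta0 phinear]]]]]] := kernel_exists hdelta hkappa.
have phiperk k : Periodic1 (phi k).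
  by elim: k => [//|k IH]; apply: derivative_periodic IH (phider k).
have phicont k : continuity (phi k) := derivable_lim_continuity (phider k).
have [M M1 hM] : exists2 M, 1 <= M & forall k x, (k <= r)%N -> Rabs (phi k x) <= M.
  apply: common_bound => k hk; have [x0 hx0] := periodic_abs_max (phicont k) (phiperk k).
  by exists (Rabs (phi k x0)).
have [D1 hD1] := exists_nat_ge (/ delta); have [D2 hD2] := exists_nat_ge (/ eta).
pose D := (D1 + D2).+1.
have D0 : 0 < INR D by apply: lt_0_INR; rewrite /D; lia.
have DE : INR D = INR D1 + INR D2 + 1 by rewrite /D S_INR plus_INR.
have n1 := pos_INR D1; have n2 := pos_INR D2.
have Ddelta : / INR D <= delta.
  by rewrite -(Rinv_inv delta); apply: Rinv_le_contravar; [apply: Rinv_0_lt_compat; lra | lra].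
have Deta : / INR D <= eta.
  by rewrite -(Rinv_inv eta); apply: Rinv_le_contravar; [apply: Rinv_0_lt_compat; lra | lra].
set e1 := Rmin eps 1.
have he1 : 0 < e1 by apply: Rmin_glb_lt; lra.
have e1eps : e1 <= eps := Rmin_l _ _.
have MD : 0 < M * INR D by apply: Rmult_lt_0_compat; lra.
set eps0 := e1 / (2 * (M * INR D)).
have heps0 : 0 < eps0 by apply: Rdiv_lt_0_compat; lra.
have eps0E : eps0 * M * INR D = e1 / 2 by rewrite /eps0; field; lra.
pose A := MA + eps0 * M * INR D.
pose th := (A + 1) / (lam - 1).
have A0 : 0 <= A by rewrite /A eps0E; lra.
have th0 : 0 <= th by apply: Rle_mult_inv_pos; lra.
pose Theta := th * Cdist B + lipS B A A + 1.
have [Nb hNb] := exists_nat_ge (A / (lam - 1) + th).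
have [Cw hCw] := exists_nat_ge ((16 * Theta / eps0 + 1) * Cdist B).
have [J [J0 hJ0 hlarge hsmall]] := choose_J Nb Cw p0 q0 hh hP.
have K0 : (0 < Q ^ (J * q))%N by rewrite expn_gt0; have := INR_lt 0 _ (Rlt_trans _ _ _ Rlt_0_1 Q_gt1); lia.
have psiA (t : {ffun 'I_D -> 'I_(Q ^ (J * q))}) x : Rabs (pert eps0 (d 1%N) (phi 1%N) t x) <= A.
  by apply: pert_bound => // y; [apply: hMA | apply: hM]; lia.
have psiL (t : {ffun 'I_D -> 'I_(Q ^ (J * q))}) x y :
    Rabs (pert eps0 (d 1%N) (phi 1%N) t x - pert eps0 (d 1%N) (phi 1%N) t y) <= A * Rabs (x - y).
  apply: pert_lip => //.
    by apply: (@lipschitz_of_deriv _ (d 2%N)) => z; [apply: dder; lia | apply: hMA; lia].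
  by apply: (@lipschitz_of_deriv _ (phi 2%N)) => z; [apply: phider | apply: hM; lia].
have [t ht] : exists t : {ffun 'I_D -> 'I_(Q ^ (J * q))}, forall x s,
    (hits B (pert eps0 (d 1%N) (phi 1%N) t) th (J * q) x s <= (2 * (q.+1.*2.+1 * p)) ^ J * (l ^ q * h ^ J))%N.
  apply: (@exists_good B p q J D eps0 (d 1%N) (phi 1%N) kappa delta eta A A th) hNb hCw hJ0 hlarge => //.
  - by apply: dper; lia.
  - lra.
pose sg k := pert eps0 (d k) (phi k) t.
have hsg : DerivSeq r (sg 0%N) sg.
  split=> //; split; first by move=> k x hk; apply: derivable_pert => //; apply: dder; apply/ltP.
  by apply: continuity_pert => //; apply: DerivSeq_continuity hd.
have hsg1 x : derivable_pt_lim (sg 0%N) x (sg 1%N x).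
  by apply: derivable_pert => //; apply: dder; lia.
exists (sg 0%N); split.
  split; first by split; [exists sg | apply: pert_per => //; apply: dper].
  exists (sg 1%N), A, (A + 1), (J * q)%N, ((2 * (q.+1.*2.+1 * p)) ^ J * (l ^ q * h ^ J))%N.
  split; first exact: hsg1.
  split; first by move=> x; apply: psiA.
  split; first lra.
  by split; first rewrite muln_gt0 J0.
exists sg, d; split=> //; split=> // k x /leP hk.
have -> : sg k x - d k x = \big[Rplus/0]_(c < D) (coef eps0 t c * phi k (x - center c)) by rewrite /sg /pert; ring.
apply: Rle_lt_trans (_ : eps0 * M * INR D < _); last by rewrite eps0E; lra.
apply: rsum_bound_const => c; have hc := coef_bound K0 heps0 t c.
rewrite Rabs_mult (Rabs_right (coef _ _ _)); last lra.
by apply: Rmult_le_compat; [lra | apply: Rabs_pos | lra | apply: hM].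
Qed.

End Density.

Lemma lift_surjective (l : nat) (E : R -> R) X : (1 <= l)%N -> continuity E -> CircleLift l E ->
  exists y, E y = X.
Proof.
move=> hl hc hE.
have hp : forall x, E (x + 1) - (x + 1) * INR l = E x - x * INR l.
  by move=> x; rewrite hE; ring.
have hZ := Periodic1_Z (psi := fun x => E x - x * INR l) hp.
have [n hn] := INR_unbounded (Rabs (X - E 0)).
have l1 : 1 <= INR l by apply: (INR_leq (a := 1)).
have n0 : 0 < INR n by have := Rabs_pos (X - E 0); lra.
have b1 := Rle_abs (X - E 0); have b2 := Rle_abs (- (X - E 0)); rewrite Rabs_Ropp in b2.
have e1 := hZ 0 (Z.of_nat n); have e2 := hZ 0 (- Z.of_nat n)%Z.
rewrite opp_IZR -INR_IZR_INZ !Rplus_0_l Rmult_0_l in e2; rewrite -INR_IZR_INZ !Rplus_0_l Rmult_0_l in e1.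
have [||||y [_ hy]] := IVT (fun y => E y - X) (- INR n) (INR n).
- by apply: continuity_minus => //; apply: continuity_const => ? ?.
- lra.
- nra.
- nra.
by exists y; lra.
Qed.

Lemma expanding_lift_exists (r l : nat) (E : R -> R) (dE : nat -> R -> R) (lam Lam : R) :
  (2 <= r)%N -> (2 <= l)%N -> DerivSeq r E dE -> CircleLift l E -> 1 < lam ->
  (forall x, lam <= dE 1%N x <= Lam) ->
  exists B : expanding_lift, [/\ Emap B = E, Eder B = dE 1%N & minexp B = lam].
Proof.
move=> hr hl hd hE hlam hbd.
have der1 := DerivSeq_der1 (ltnW hr) hd.
have der2 x : derivable_pt_lim (dE 1%N) x (dE 2%N x).
  by case: hd => _ [h _]; apply: h; apply/ltP.
have per1 : Periodic1 (dE 1%N).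
  have p0 : Periodic1 (fun x => E x - x * INR l) by move=> x; rewrite hE; ring.
  have d0 x : derivable_pt_lim (fun x => E x - x * INR l) x (dE 1%N x - (1 * INR l + x * 0)).
    apply: (derivable_pt_lim_minus E (fun x => x * INR l)) => //.
    exact: (derivable_pt_lim_mult id (fct_cte (INR l)) x _ _ (derivable_pt_lim_id x) (derivable_pt_lim_const _ x)).
  by move=> x; have := derivative_periodic p0 d0 x; lra.
have per2 := derivative_periodic per1 der2.
have [x0 hx0] := periodic_abs_max (DerivSeq_continuity hr hd) per2.
have [Q hQ] := exists_nat_ge Lam.
have surj X := lift_surjective X (ltnW hl) (derivable_lim_continuity der1) hE.
pose G X := proj1_sig (constructive_indefinite_description _ (surj X)).
have EG X : E (G X) = X by rewrite /G; case: constructive_indefinite_description.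
have h1 x : lam <= dE 1%N x by have := hbd x; lra.
have h2 x : dE 1%N x <= INR Q by have := hbd x; lra.
by exists (@ExpandingLift E (dE 1%N) G l Q lam (Rabs (dE 2%N x0)) hl der1 hE hlam h1 h2
  (Rabs_pos _) (lipschitz_of_deriv der2 hx0) EG).
Qed.

Lemma residual_of_small_growth (B : expanding_lift) (r : nat) : (2 <= r)%N ->
  exists Res, ResidualCr r Res /\
    forall tau, Res tau -> NLimit (Emap B) (Eder B) tau (minexp B) 1.
Proof.
move=> hr; have hr1 := ltnW hr.
pose rho n := 1 + / INR n.+1.
have hrho n : 1 < rho n by rewrite /rho; have : 0 < / INR n.+1 by [apply: Rinv_0_lt_compat; apply: lt_0_INR; lia]; lra.
exists (fun tau => CrS1 r tau /\ NLimit (Emap B) (Eder B) tau (minexp B) 1).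
split; last by move=> tau [].
split; first by move=> tau [].
exists (fun n => small_growth B r (rho n)); split.
  by move=> n; split; [apply: small_growth_open | apply: small_growth_dense].
move=> tau hC hU; split=> //.
have [Lim [hL hL1]] := small_growth_NLimit hr1 (hrho 0%N) (hU 0%N).
have [_ [psi [A [R0 [_ [_ [hpsi [hA [hAR _]]]]]]]]] := hU 0%N.
suff -> : 1 = Lim by [].
apply: Rle_antisym; first lra.
apply: Rnot_lt_le => hlt.
have [n hn] := INR_unbounded (/ (Lim - 1)).
have [Lim' [hL' hL1']] := small_growth_NLimit hr1 (hrho n) (hU n).
have hR x : Rabs (psi x) < R0 by have := hA x; lra.
rewrite (NLimit_unique hpsi hR hL' hL) in hL1'.
have h1 : 0 < / (Lim - 1) by apply: Rinv_0_lt_compat; lra.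
have : / INR n.+1 < Lim - 1.
  by rewrite -(Rinv_inv (Lim - 1)) S_INR; apply: Rinv_lt_contravar; nra.
rewrite /rho in hL1'; lra.
Qed.

Import Init.Peano.
Open Scope R_scope.
Unset Implicit Arguments.

Theorem theorem1 (r : nat) (l : nat) (E : R -> R) (dE : nat -> R -> R)
  (lam Lam : R) :
  (2 <= r)%nat -> (2 <= l)%nat ->
  DerivSeq r E dE -> CircleLift l E ->
  1 < lam -> lam <= Lam ->
  (forall x, lam <= dE 1%nat x <= Lam) ->
  (forall rho : R, rho > 1 ->
     exists V : (R -> R) -> Prop,
       OpenCr r V /\ DenseCr r V /\
       forall tau, V tau -> exists Lim, NLimit E (dE 1%nat) tau lam Lim /\ Lim < rho)
  /\
  (exists Res : (R -> R) -> Prop,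
     ResidualCr r Res /\
     forall tau, Res tau -> NLimit E (dE 1%nat) tau lam 1).
Proof.
move=> /leP hr /leP hl hd hE hlam _ hbd.
have [B [<- <- <-]] := expanding_lift_exists hr hl hd hE hlam hbd.
split; last exact: residual_of_small_growth.
move=> rho hrho; exists (small_growth B r rho).
split; first exact: small_growth_open (ltnW hr).
split; first exact: small_growth_dense.
move=> tau hV; have [Lim [h1 h2]] := small_growth_NLimit (ltnW hr) hrho hV.
by exists Lim; split=> //; lra.
Qed.
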